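(* Let $G_1$ be a torsion-free finitely generated nilpotent group, regarded as a subgroup of $(\mathfrak{u}^0(n,\mathbb{Q}),\ast)$ for some $n$, and let $H\leq \mathrm{Aut}(G_1)$ be a subgroup. Then there exists an $H$-invariant LR-group $G_2 \leq G_1$ such that $\mathrm{RF}_{G_1, \mathcal{P}_{H\curvearrowright G_1}} \approx \mathrm{RF}_{G_2, \mathcal{P}_{H\curvearrowright G_2}}$, where $H$ acts on $G_2$ by restriction.
   Context: Let $\mathfrak{u}^0(n,\mathbb{Q})$ be the Lie algebra of strictly upper triangular $n\times n$ rational matrices with bracket $[A,B]_L=AB-BA$, made into a group by $A\ast B=\log(\exp(A)\exp(B))$ (Baker-Campbell-Hausdorff). Every torsion-free finitely generated nilpotent group is isomorphic to a subgroup of $(\mathfrak{u}^0(n,\mathbb{Q}),\ast)$ for some $n$. An LR-group is a finitely generated subgroup of $(\mathfrak{u}^0(n,\mathbb{Q}),\ast)$ that is also closed under addition and under the bracket $[\cdot,\cdot]_L$. A subgroup $N\le G_1$ is $H$-invariant if $\xi(N)=N$ for all $\xi\in H$. Let $G$ be a finitely generated residually finite group with finite generating set $S$. The word norm is $\|g\|_{G,S} = \min\{k\ge 0 \mid g = s_1\cdots s_k,\ s_i\in S\cup S^{-1}\}$. For a set $\mathcal{P}$ of normal subgroups of $G$ and $g\in G\setminus\{e\}$ put $D_{G,\mathcal{P}}(g) = \min\{[G:N] \mid N\in\mathcal{P},\ g\notin N\}$ ($\min\emptyset=\infty$). Define $\mathrm{RF}_{G,\mathcal{P},S}(r) = \max\{D_{G,\mathcal{P}}(g)\mid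 0<\|g\|_{G,S}\le r\}$ for real $r\ge 1$, with the convention $\max\emptyset = 1$. For non-decreasing functions $f,g$ on $[1,\infty)$ with values in $[0,\infty]$, write $f\preceq g$ if there exists $C>0$ such that $f(r)\le C g(Cr)$ for all $r\ge \max\{1,1/C\}$, and $f\approx g$ if $f\preceq g$ and $g\preceq f$. Up to $\approx$, $\mathrm{RF}_{G,\mathcal{P},S}$ does not depend on $S$ and is denoted $\mathrm{RF}_{G,\mathcal{P}}$. If $H$ acts on $G$ by automorphisms, $\mathcal{P}_{H\curvearrowright G}$ is the set of $H$-invariant normal subgroups of $G$. *)

(* Defs.v *)
From HB Require Import structures.
From mathcomp Require Import all_boot all_order all_algebra.
From mathcomp Require Import finmap.
From mathcomp Require Import all_classical all_reals ereal.
From mathcomp Require Import ring.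

Set Implicit Arguments.
Unset Strict Implicit.
Unset Printing Implicit Defensive.

Import Order.TTheory GRing.Theory Num.Theory.
Local Open Scope ring_scope.

Section TruncatedSeries.

(* Congruence of power series modulo X^m. *)
Definition eqX (m : nat) (p q : {poly rat}) := forall i, (i < m)%N -> p`_i = q`_i.

Definition expP (m : nat) : {poly rat} := \sum_(k < m) (k`!%:R^-1 : rat) *: 'X^k.

(* The truncated series of ln (1 + X). *)
Definition logP (m : nat) : {poly rat} :=
  \sum_(k < m) ((-1) ^+ k / k.+1%:R : rat) *: 'X^(k.+1).

Lemma eqXP m p q : eqX m p q <-> exists r, p = q + r * 'X^m.
Proof.
split=> [h | [r ->] i im]; last by rewrite coefD coefMXn im addr0.
exists (drop_poly m (p - q)); rewrite -[p in LHS](subrK q) addrC; congr (_ + _).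
rewrite -[LHS](poly_take_drop m) [X in X + _](_ : _ = 0) ?add0r//.
apply/polyP => i; rewrite coef_take_poly coef0.
by case: ifP => // im; rewrite coefB h ?subrr.
Qed.

Lemma eqX_trans m q p r : eqX m p q -> eqX m q r -> eqX m p r.
Proof. by move=> h1 h2 i im; rewrite h1 ?h2. Qed.

Lemma eqX_sym m p q : eqX m p q -> eqX m q p.
Proof. by move=> h i im; rewrite h. Qed.

Lemma eqXM m p p' q q' : eqX m p p' -> eqX m q q' -> eqX m (p * q) (p' * q').
Proof.
move=> /eqXP[r ->] /eqXP[s ->]; apply/eqXP.
by exists (r * q' + p' * s + r * s * 'X^m); ring.
Qed.

Lemma eqX_comp m (p q s : {poly rat}) : eqX m p q -> s`_0 = 0 -> eqX m (p \Po s) (q \Po s).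
Proof.
move=> /eqXP[r ->] s0; apply/eqXP.
have /eqXP[t ->] : eqX 1 s 0 by case=> // _; rewrite coef0.
rewrite add0r; exists ((r \Po (t * 'X^1)) * t ^+ m).
by rewrite comp_polyD comp_polyM comp_Xn_poly exprMn expr1 mulrA.
Qed.

Lemma comp_coef0 (p s : {poly rat}) : s`_0 = 0 -> (p \Po s)`_0 = p`_0.
Proof. by move=> s0; rewrite -[LHS]horner_coef0 horner_comp horner_coef0 s0 horner_coef0. Qed.

Lemma expP_coef m i : (expP m)`_i = if (i < m)%N then i`!%:R^-1 else 0.
Proof. by rewrite /expP -(poly_def m (fun k => k`!%:R^-1)) coef_poly. Qed.

Lemma logP_coef m i :
  (logP m)`_i.+1 = if (i < m)%N then (-1) ^+ i / i.+1%:R else 0.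
Proof.
rewrite /logP (eq_bigr (fun k : 'I_m =>
  (((-1) ^+ k / k.+1%:R : rat) *: 'X^k) * 'X)); last first.
  by move=> k _; rewrite -scalerAl exprSr.
by rewrite -mulr_suml -(poly_def m (fun k => (-1) ^+ k / k.+1%:R)) coefMX coef_poly.
Qed.

Lemma logP_coef0 m : (logP m)`_0 = 0.
Proof.
rewrite /logP coef_sum big1// => k _.
by rewrite coefZ coefXn/= mulr0.
Qed.

Lemma expP_deriv m : (expP m.+1)^`() = expP m.
Proof.
apply/polyP => i; rewrite coef_deriv !expP_coef ltnS.
case: ifP => _; last by rewrite mul0rn.
by rewrite -[LHS]mulr_natr factS natrM invfM mulrAC mulVf ?mul1r// pnatr_eq0.
Qed.

Lemma eqX_exp m : eqX m (expP m) (expP m.+1).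
Proof. by move=> i im; rewrite !expP_coef im ltnS ltnW. Qed.

Lemma logP_deriv m : eqX m ((1 + 'X) * (logP m)^`()) 1.
Proof.
move=> i im; rewrite mulrDl mul1r coefD coefXM coef1.
have d j : (j < m)%N -> (logP m)^`()`_j = (-1) ^+ j.
  move=> jm; by rewrite coef_deriv logP_coef jm -[LHS]mulr_natr divfK// pnatr_eq0.
rewrite d//; case: i im => [|i] im /=; first by rewrite expr0 addr0.
by rewrite d ?(ltnW im)// exprS mulN1r addNr.
Qed.

Lemma eqX_deriv_inj m (p q : {poly rat}) :
  p`_0 = q`_0 -> eqX m p^`() q^`() -> eqX m.+1 p q.
Proof.
move=> h0 h [//|i] im; have := h i im; rewrite !coef_deriv => e.
by apply: (@mulIf _ i.+1%:R); rewrite ?pnatr_eq0// !mulr_natr.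
Qed.

Lemma expP_logP m : eqX m.+1 (expP m.+1 \Po logP m) (1 + 'X).
Proof.
set F := _ \Po _.
have F0 : F`_0 = 1 by rewrite /F comp_coef0 ?logP_coef0// expP_coef/= invr1.
have dF : eqX m ((1 + 'X) * F^`()) F.
  rewrite /F deriv_comp expP_deriv mulrCA -[X in eqX _ _ X]mulr1.
  apply: eqXM; last exact: logP_deriv.
  by apply: eqX_comp; [exact: eqX_exp|exact: logP_coef0].
have rec i : (i < m)%N -> F`_i.+1 *+ i.+1 = F`_i - F`_i *+ i.
  move=> im; have := dF i im; rewrite mulrDl mul1r coefD coefXM !coef_deriv.
  case: i im => [|i] im /= e; first by rewrite mulr0n subr0 -e addr0.
  by rewrite -[X in X - _]e addrK.
have F1 : (0 < m)%N -> F`_1 = 1.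
  by move=> m0; have := rec 0 m0; rewrite mulr1n mulr0n subr0 F0.
move=> [|i] im; first by rewrite F0 coefD coef1 coefX addr0.
rewrite coefD coef1 coefX/= add0r.
case: i im => [|i] im; first exact: F1.
elim: i im => [|i IH] im.
  have := rec 1%N im; rewrite mulr1n subrr => /eqP.
  by rewrite mulrn_eq0 => /eqP.
have := rec i.+2 im; rewrite IH ?(ltnW im)//= mul0rn subrr => /eqP.
by rewrite mulrn_eq0 => /eqP.
Qed.

Lemma logP_expP m : eqX m.+1 (logP m \Po (expP m.+1 - 1)) 'X.
Proof.
have e0 : (expP m.+1 - 1)`_0 = 0.
  by rewrite coefB expP_coef/= coef1 invr1 subrr.
apply: eqX_deriv_inj; first by rewrite comp_coef0// logP_coef0 coefX.
rewrite deriv_comp derivB derivC subr0 expP_deriv derivX mulrC.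
have := eqX_comp (@logP_deriv m) e0.
rewrite comp_polyM comp_polyD comp_polyC comp_polyX.
rewrite [_%:P + _]addrC subrK; apply: eqX_trans.
by apply: eqXM => //; exact: eqX_exp.
Qed.

Lemma expP_expPN m : eqX m.+1 (expP m.+1 * (expP m.+1 \Po - 'X)) 1.
Proof.
have x0 : (- 'X : {poly rat})`_0 = 0 by rewrite coefN coefX oppr0.
apply: eqX_deriv_inj.
  by rewrite -!horner_coef0 hornerM !horner_coef0 comp_coef0// expP_coef/= invr1
    mulr1 coef1.
rewrite derivM deriv_comp expP_deriv derivN derivX mulrN1 mulrN derivC.
set E := expP m.+1; set e := expP m.
have hE : eqX m (E * (E \Po -'X)) (e * (E \Po -'X)).
  by apply: eqXM => //; apply: eqX_sym; exact: eqX_exp.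
have hE2 : eqX m (E * (E \Po -'X)) (E * (e \Po -'X)).
  by apply: eqXM => //; apply: eqX_comp => //; apply: eqX_sym; exact: eqX_exp.
by move=> i im; rewrite coefB -hE// -hE2// subrr coef0.
Qed.

End TruncatedSeries.

(* The exponential series of A and the logarithm series of B; the truncation at
   degree n is harmless since (A ^+ n) and ((B - 1) ^+ n) vanish when A and
   B - 1 are strictly upper triangular of size n. *)
Definition expmx (n : nat) (A : 'M[rat]_n) : 'M[rat]_n :=
  \sum_(k < n) (k`!%:R^-1 : rat) *: A ^+ k.

Definition logmx (n : nat) (B : 'M[rat]_n) : 'M[rat]_n :=
  \sum_(1 <= k < n) ((-1) ^+ k.+1 / k%:R : rat) *: (B - 1) ^+ k.

Definition strict_upper (n : nat) : pred 'M[rat]_n :=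
  fun A => [forall i : 'I_n, forall j : 'I_n, (j <= i)%N ==> (A i j == 0)].
Arguments strict_upper : clear implicits.

Section StrictUpper.
Variable n : nat.
Implicit Types A B : 'M[rat]_n.

Lemma strict_upperP A :
  reflect (forall i j : 'I_n, (j <= i)%N -> A i j = 0) (strict_upper n A).
Proof.
apply: (iffP forallP) => [h i j ji | h i].
  by have /forallP/(_ j) := h i; rewrite ji => /eqP.
by apply/forallP => j; apply/implyP => /h/eqP.
Qed.

Lemma strict_upper_zmod : zmod_closed (strict_upper n).
Proof.
split; first by apply/strict_upperP => i j _; rewrite mxE.
move=> A B /strict_upperP hA /strict_upperP hB; apply/strict_upperP => i j ji.
by rewrite !mxE hA// hB// subrr.
Qed.

HB.instance Definition _ :=
  GRing.isZmodClosed.Build 'M[rat]_n (strict_upper n) strict_upper_zmod.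

Lemma strict_upperM A B : A \in strict_upper n -> B \in strict_upper n ->
  A *m B \in strict_upper n.
Proof.
move=> /strict_upperP hA /strict_upperP hB; apply/strict_upperP => i j ji.
rewrite mxE big1// => k _; have [ki|ik] := leqP k i; first by rewrite hA ?mul0r.
by rewrite hB ?mulr0// (leq_trans ji)// ltnW.
Qed.

Lemma strict_upperZ (a : rat) A :
  A \in strict_upper n -> a *: A \in strict_upper n.
Proof.
move=> /strict_upperP hA; apply/strict_upperP => i j ji.
by rewrite mxE hA ?mulr0.
Qed.

Lemma strict_upperX A k :
  A \in strict_upper n -> A ^+ k.+1 \in strict_upper n.
Proof.
move=> hA; elim: k => // k IH; rewrite exprS; exact: strict_upperM.
Qed.

Lemma strict_upper_nilp A : A \in strict_upper n -> A ^+ n = 0.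
Proof.
move=> /strict_upperP hA.
have h k : forall i j : 'I_n, (j < i + k)%N -> (A ^+ k) i j = 0.
  elim: k => [|k IH] i j ji.
    rewrite addn0 in ji.
    by rewrite expr0 mxE; case: eqP => // e; rewrite e ltnn in ji.
  rewrite exprS mxE big1// => l _; have [li|il] := leqP l i.
    by rewrite hA ?mul0r.
  by rewrite IH ?mulr0// (leq_trans ji)// addnS -addSn leq_add2r.
by apply/matrixP => i j; rewrite h ?mxE// ltn_addl.
Qed.

Lemma strict_upper_log B :
  B - 1 \in strict_upper n -> logmx B \in strict_upper n.
Proof.
move=> hB; rewrite /logmx big_nat; apply: rpred_sum => -[//|k] _.
by apply: strict_upperZ; exact: strict_upperX.
Qed.

End StrictUpper.

Lemma strict_upper_exp1 n (A : 'M[rat]_n) :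
  A \in strict_upper n -> expmx A - 1 \in strict_upper n.
Proof.
case: n A => [|n] A hA.
  by rewrite (flatmx0 (_ - _)) rpred0.
rewrite /expmx big_ord_recl expr0 fact0 invr1 scale1r addrC addKr.
by apply: rpred_sum => k _; apply: strict_upperZ; exact: strict_upperX.
Qed.

Section Horner.
Variable n : nat.
Implicit Types A B : 'M[rat]_n.+1.

Lemma expmxE A : expmx A = horner_mx A (expP n.+1).
Proof.
rewrite /expP linear_sum; apply: eq_bigr => k _ /=.
by rewrite linearZ/= rmorphXn/= horner_mx_X.
Qed.

Lemma logmxE B : logmx B = horner_mx (B - 1) (logP n).
Proof.
rewrite /logP linear_sum /logmx big_add1/= big_mkord; apply: eq_bigr => k _ /=.
rewrite linearZ/= rmorphXn/= horner_mx_X; congr (_ / _ *: _).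
by rewrite !exprS mulrA mulrNN mulr1 mul1r.
Qed.

Lemma horner_mx_eqX A p q : A \in strict_upper n.+1 ->
  eqX n.+1 p q -> horner_mx A p = horner_mx A q.
Proof.
move=> hA /eqXP[r ->]; rewrite rmorphD rmorphM/= rmorphXn/= horner_mx_X.
by rewrite strict_upper_nilp// mulr0 addr0.
Qed.

Lemma horner_mx_comp A p q :
  horner_mx A (p \Po q) = horner_mx (horner_mx A q) p.
Proof.
elim/poly_ind: p => [|p c IH]; first by rewrite comp_poly0 !rmorph0.
rewrite comp_polyD comp_polyM comp_polyX comp_polyC !rmorphD !rmorphM/= IH.
by rewrite horner_mx_X !horner_mx_C.
Qed.

End Horner.

Lemma expmxK n (A : 'M[rat]_n) : A \in strict_upper n -> logmx (expmx A) = A.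
Proof.
case: n A => [|n] A hA; first by rewrite [RHS]flatmx0 [LHS]flatmx0.
rewrite logmxE expmxE -(rmorph1 (horner_mx A)) -rmorphB/= -horner_mx_comp.
by rewrite (horner_mx_eqX hA (@logP_expP n)) horner_mx_X.
Qed.

Lemma logmxK n (B : 'M[rat]_n) :
  B - 1 \in strict_upper n -> expmx (logmx B) = B.
Proof.
case: n B => [|n] B hB; first by rewrite [RHS]flatmx0 [LHS]flatmx0.
rewrite logmxE expmxE -horner_mx_comp.
rewrite (horner_mx_eqX hB (@expP_logP n)) rmorphD rmorph1/= horner_mx_X.
by rewrite addrC subrK.
Qed.

Lemma expmxMN n (A : 'M[rat]_n) :
  A \in strict_upper n -> expmx A * expmx (- A) = 1.
Proof.
case: n A => [|n] A hA; first by rewrite [RHS]flatmx0 [LHS]flatmx0.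
have -> : expmx (- A) = horner_mx A (expP n.+1 \Po - 'X).
  by rewrite horner_mx_comp rmorphN/= horner_mx_X expmxE.
rewrite expmxE -rmorphM/=.
by rewrite (horner_mx_eqX hA (@expP_expPN n)) rmorph1.
Qed.

Lemma expmx0 n : expmx (0 : 'M[rat]_n) = 1.
Proof.
case: n => [|n]; first by rewrite [RHS]flatmx0 [LHS]flatmx0.
rewrite /expmx big_ord_recl expr0 fact0 invr1 scale1r big1 ?addr0// => k _.
by rewrite expr0n/= scaler0.
Qed.

Record u0 (n : nat) := U0 { u0val : 'M[rat]_n; _ : strict_upper n u0val }.

HB.instance Definition _ n := [isSub for @u0val n].
HB.instance Definition _ n := [Choice of u0 n by <:].
HB.instance Definition _ n := [SubChoice_isSubZmodule of u0 n by <:].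

Section U0.
Variable n : nat.
Implicit Types A B C : u0 n.

Lemma strict_upper_expM A B :
  expmx (val A) * expmx (val B) - 1 \in strict_upper n.
Proof.
move: (strict_upper_exp1 (valP A)) (strict_upper_exp1 (valP B)).
set a := expmx _; set b := expmx _ => ha hb.
have -> : a * b - 1 = (a - 1) * (b - 1) + ((a - 1) + (b - 1)).
  rewrite mulrBl mulrBr mulr1 mul1r opprB addrACA [b - 1]addrC.
  by rewrite addrA [RHS]addrA addrAC !addrA !subrK.
by apply: rpredD; [exact: strict_upperM|exact: rpredD].
Qed.

Definition bch A B : u0 n := U0 (strict_upper_log (strict_upper_expM A B)).

Lemma bracket_subproof A B :
  strict_upper n (val A *m val B - val B *m val A).
Proof. by apply: rpredB; apply: strict_upperM; apply: valP. Qed.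

Definition bracket A B : u0 n := U0 (bracket_subproof A B).

Lemma expmx_bch A B : expmx (val (bch A B)) = expmx (val A) * expmx (val B).
Proof. by apply: logmxK; exact: strict_upper_expM. Qed.

Lemma expmx_inj A B : expmx (val A) = expmx (val B) -> A = B.
Proof.
move=> e; apply: val_inj.
by rewrite -(expmxK (valP A)) e; exact: expmxK (valP B).
Qed.

Lemma bchA : associative bch.
Proof. by move=> A B C; apply: expmx_inj; rewrite !expmx_bch mulrA. Qed.

Lemma bch0A : left_id 0 bch.
Proof. by move=> A; apply: expmx_inj; rewrite expmx_bch expmx0 mul1r. Qed.

Lemma bchA0 : right_id 0 bch.
Proof. by move=> A; apply: expmx_inj; rewrite expmx_bch expmx0 mulr1. Qed.

Lemma bchAN : right_inverse 0 -%R bch.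
Proof.
move=> A; apply: expmx_inj; rewrite expmx_bch expmx0 expmxMN//; exact: valP.
Qed.

Lemma bchNA : left_inverse 0 -%R bch.
Proof. by move=> A; rewrite -[X in bch _ X]opprK bchAN. Qed.

HB.instance Definition _ :=
  isGroup.Build (u0 n) bchA bch0A bchA0 bchNA bchAN.

End U0.

Local Open Scope classical_set_scope.

(* Groups and their subgroups are represented by subsets of an ambient
   (possibly infinite) group gT. *)
Section GroupNotions.
Local Open Scope group_scope.
Variable gT : groupType.
Implicit Types (G N S : set gT) (f : gT -> gT) (H : set (gT -> gT)).

Definition subgroup G :=
  [/\ G 1, (forall x y, G x -> G y -> G (x * y)) & forall x, G x -> G x^-1].

Definition generated S : set gT := smallest subgroup S.

Definition finite_generating_set G S := finite_set S /\ generated S = G.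

Definition finitely_generated G := exists S, finite_generating_set G S.

Definition torsion_free G :=
  forall x k, G x -> (0 < k)%N -> x ^+ k = 1 -> x = 1.

Fixpoint lower_central G (k : nat) : set gT :=
  if k is k'.+1
  then generated [set [~ x, y] | x in lower_central G k' & y in G]
  else G.

Definition nilpotent_group G := exists c, lower_central G c = [set 1].

Definition normal_subgroup G N :=
  [/\ subgroup N, N `<=` G & forall x g, N x -> G g -> N (x ^ g)].

(* An automorphism of G is a self-map of gT fixing every point outside G, so
   that distinct maps always represent distinct automorphisms. *)
Definition automorphism G : set (gT -> gT) :=
  [set f | [/\ set_bij G G f,
               (forall x y, G x -> G y -> f (x * y) = f x * f y)
             & forall x, ~ G x -> f x = x]].

Definition subgroup_of_Aut G H :=
  [/\ H `<=` automorphism G, H id,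
      (forall f1 f2, H f1 -> H f2 -> H (f1 \o f2))
    & forall f, H f -> exists2 f', H f' & cancel f f'].

Definition H_invariant H N := forall f, H f -> f @` N = N.

Definition invariant_normal_subgroups H G : set (set gT) :=
  [set N | normal_subgroup G N /\ H_invariant H N].

Definition expressible_by_word S (g : gT) (k : nat) :=
  exists s : seq gT, [/\ size s = k, {in s, forall x, S x \/ S x^-1}
                       & \prod_(x <- s) x = g].

Section ResidualFiniteness.
Local Open Scope ereal_scope.
Variable R : realType.

Definition word_norm S (g : gT) : \bar R :=
  ereal_inf [set k%:R%:E | k in expressible_by_word S g].

Definition left_cosets G N : set (set gT) :=
  [set [set (x * y)%g | y in N] | x in G].

Definition subgroup_index G N : \bar R :=
  if `[< finite_set (left_cosets G N) >]
  then (#|` fset_set (left_cosets G N)|)%:R%:E else +oo.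

(* The minimum of [G : N] over the members N of P avoiding g, +oo if none. *)
Definition separation_index G (P : set (set gT)) (g : gT) : \bar R :=
  ereal_inf [set subgroup_index G N | N in [set N | P N /\ ~ N g]].

(* The empty case implements the convention that the maximum of the empty set is 1. *)
Definition RF G (P : set (set gT)) S (r : R) : \bar R :=
  let D := [set separation_index G P g |
              g in [set g | G g /\ 0 < word_norm S g <= r%:E]] in
  if D == set0 then 1 else ereal_sup D.

End ResidualFiniteness.
End GroupNotions.

Section Growth.
Local Open Scope ereal_scope.
Variable R : realType.
Implicit Types f g : R -> \bar R.

Definition growth_le f g := exists2 C : R, (0 < C)%R &
  forall r : R, (Num.max 1 C^-1 <= r)%R -> f r <= C%:E * g (C * r)%R.

Definition growth_eq f g := growth_le f g /\ growth_le g f.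

End Growth.

Definition LR_group n (G : set (u0 n)) :=
  [/\ subgroup G, finitely_generated G,
      (forall A B, G A -> G B -> G (A + B)%R)
    & forall A B, G A -> G B -> G (bracket A B)].

(* Main.v *)
Require Import Defs.
From HB Require Import structures.
From mathcomp Require Import all_boot all_order all_algebra.
From mathcomp Require Import finmap.
From mathcomp Require Import all_classical all_reals ereal.
From mathcomp Require Import ring zify.

(** Write x * y for the Campbell-Hausdorff product.  The group [G2] is [K] times
    the additive group L generated by [G1], for a suitable integer [K]
    ([scaled_span], [exists_LR_multiple]).

    The key fact is that a fixed multiple of x + y, with a factor depending on
    the size of the matrices only, is the value of an explicit group word at x
    and y ([sumwordE]).  The path t |-> tx * ty is polynomial with linear term
    t(x + y), and Richardson extrapolation eliminates its higher terms one by
    one through group operations; the nilpotency of the matrices bounds the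
    degree.  Hence every subgroup contains fixed multiples of the sums of
    boundedly many of its elements, and homomorphisms of subgroups are linear
    wherever that makes sense.  So the automorphisms in [H] preserve [G2].

    The coordinates of an integral matrix in a basis chosen in [G1] have bounded
    denominators ([qspan_lattice]), and so do the elements of the finitely
    generated group [G1] ([bounded_denominators]).  It follows that a multiple
    of L lies in [G1].
    The terms of (Kx) * (Ky) beyond K(x + y), like the bracket of Kx and Ky, lie
    in the rational span of [G1] and carry a factor K ^ 2 over a fixed
    denominator ([bch_second_order]); if K is divisible enough, they lie in KL
    again.  This makes [G2] an LR-group.

    Raising to the K-th power maps [G1] into [G2].  The matrices of u0 are
    filtered by the position of their first nonzero entry, and a subgroup with
    bounded denominators has cyclic layers ([cyclic_layer]).  So such a subgroup
    is finitely generated, and a subgroup of it that contains all M-th powers has index at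
    most M ^ (n ^ 2) ([covered_powers]).  In particular [G2] has finite index in
    [G1], hence is undistorted ([finite_index_undistorted]).

    For the growth functions, an invariant normal subgroup of [G1] that avoids
    g is intersected with [G2].  Conversely let N be an invariant normal
    subgroup of [G2] that avoids the K-th power of g.  Its normal core in [G1]
    is invariant, and what has to be seen is that its index in N is bounded
    independently of N.  For x in N and g in [G1] the conjugate of x by the t-th
    power of g is polynomial in t, and it lies in N if t is divisible by K.  By
    Lagrange interpolation a fixed multiple of its value at t = 1 is an integral
    combination of boundedly many of these values, so a fixed power of the
    conjugate lies in N ([subgroup_conj_multiple]).  Thus the core contains the
    M-th power of each element of N for a fixed M, and the index bound applies. *)

Set Implicit Arguments.
Unset Strict Implicit.
Unset Printing Implicit Defensive.

Import Order.TTheory GRing.Theory Num.Theory.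
Local Open Scope ring_scope.

(** * Powers in the group are multiples in the vector space *)

Lemma coef_comp_scaleX (p : {poly rat}) (a : rat) i :
  (p \Po (a *: 'X))`_i = p`_i * a ^+ i.
Proof.
rewrite comp_polyE coef_sum.
under eq_bigr => k _ do rewrite exprZn scalerA coefZ coefXn.
case: (ltnP i (size p)) => [ip|pi].
  rewrite (bigD1 (Ordinal ip))//= eqxx mulr1 big1 ?addr0// => k kn.
  rewrite (_ : i == k = false) ?mulr0//; apply/negbTE.
  by apply: contra kn => /eqP e; apply/eqP/val_inj.
rewrite (nth_default _ pi) mul0r big1// => k _.
by rewrite gtn_eqF ?mulr0// (leq_trans (ltn_ord k)).
Qed.

(** The addition formula of the exponential, coefficientwise: this is the
    binomial formula. *)
Lemma expP_add m (a b : rat) :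
  eqX m ((expP m \Po (a *: 'X)) * (expP m \Po (b *: 'X)))
        (expP m \Po ((a + b) *: 'X)).
Proof.
move=> i im; rewrite coefM coef_comp_scaleX expP_coef im addrC exprDn mulr_sumr.
apply: eq_bigr => j _; have ji : (j <= i)%N by rewrite -ltnS.
rewrite !coef_comp_scaleX !expP_coef (leq_ltn_trans ji im).
rewrite (leq_ltn_trans (leq_subr _ _) im).
have := bin_fact ji => /(congr1 (fun k : nat => k%:R : rat)).
rewrite !natrM => <-; rewrite -mulr_natr.
have f k : (k`!%:R : rat) != 0 by rewrite pnatr_eq0 -lt0n fact_gt0.
have c : ('C(i, j)%:R : rat) != 0 by rewrite pnatr_eq0 -lt0n bin_gt0.
by field; rewrite !f c.
Qed.

Lemma expmx_addZ n (A : 'M[rat]_n) (a b : rat) : A \in strict_upper n ->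
  expmx (a *: A) * expmx (b *: A) = expmx ((a + b) *: A).
Proof.
case: n A => [|n] A hA; first by rewrite [LHS]flatmx0 [RHS]flatmx0.
have e c : expmx (c *: A) = horner_mx A (expP n.+1 \Po (c *: 'X)).
  by rewrite horner_mx_comp linearZ/= horner_mx_X expmxE.
by rewrite !e -rmorphM; apply: horner_mx_eqX => //; exact: expP_add.
Qed.

Lemma strict_upperMu n (A B : 'M[rat]_n) : A \in strict_upper n ->
  B - 1 \in strict_upper n -> A * B \in strict_upper n.
Proof.
move=> hA hB; rewrite -[B](subrK 1) mulrDr mulr1 rpredD//.
exact: strict_upperM.
Qed.

Lemma strict_upperuM n (A B : 'M[rat]_n) : B \in strict_upper n ->
  A - 1 \in strict_upper n -> A * B \in strict_upper n.
Proof.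
move=> hA hB; rewrite -[A](subrK 1) mulrDl mul1r rpredD//.
exact: strict_upperM.
Qed.

Section U0Powers.
Variable n : nat.
Implicit Types x y g : u0 n.

Lemma val_mulrn x k : val (x *+ k) = k%:R *: val x.
Proof. by rewrite raddfMn/= scaler_nat. Qed.

Lemma val_mulrz x (z : int) : val (x *~ z) = z%:~R *: val x.
Proof. by rewrite (raddfMz val)/= scaler_int. Qed.

(** Multiples of [x] commute with [x] as matrices, so that exponents add. *)
Lemma expgE_mulrn x k : (x ^+ k)%g = x *+ k.
Proof.
elim: k => [//|k IH]; rewrite expgS IH; apply: expmx_inj.
rewrite expmx_bch !val_mulrn -[X in expmx X * _]scale1r expmx_addZ.
  by rewrite -natr1 addrC.
exact: (valP x).
Qed.

Lemma mulrn_inj k x y : (0 < k)%N -> x *+ k = y *+ k -> x = y.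
Proof.
move=> k0 /(congr1 val); rewrite !val_mulrn => e; apply: val_inj => /=.
by apply: (scalerI _ e); rewrite pnatr_eq0 -lt0n.
Qed.

(** Conjugation in the group is linear: it is conjugation of matrices. *)
Lemma val_conjg x g : val (x ^ g)%g = expmx (- val g) * val x * expmx (val g).
Proof.
have gV : expmx (val g) * expmx (- val g) = 1 by apply: expmxMN (valP g).
have gV' : expmx (- val g) * expmx (val g) = 1.
  by rewrite -[X in _ * expmx X]opprK expmxMN// rpredN; exact: (valP g).
set B := RHS; have hB : B \in strict_upper n.
  by apply: strict_upperMu; [apply: strict_upperuM|]; rewrite ?strict_upper_exp1// ?rpredN; exact: valP.
have Bk k : B ^+ k = expmx (- val g) * val x ^+ k * expmx (val g).
  elim: k => [|k IH]; first by rewrite !expr0 mulr1 gV'.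
  by rewrite !exprS IH /B !mulrA -(mulrA _ (expmx (val g))) gV mulr1.
rewrite -(expmxK (valP (x ^ g)%g)) -(expmxK hB); congr logmx.
rewrite !expmx_bch.
rewrite [expmx B]/expmx (eq_bigr (fun k : 'I_n =>
  expmx (- val g) * (k`!%:R^-1 *: val x ^+ k) * expmx (val g))); last first.
  by move=> k _; rewrite Bk -!mulmxE -scalemxAr -scalemxAl.
by rewrite -mulr_suml -mulr_sumr mulrA.
Qed.

End U0Powers.

(** * Polynomial paths of matrices *)

Section PolynomialPaths.
Variable n : nat.
Local Notation PM := 'M[{poly rat}]_n.+1.
Implicit Types A B C P W : PM.

(** The sums run past the nilpotency order [n.+1], so that the constant and
    the linear term are present for every [n]. *)
Definition pexp A : PM := \sum_(k < n.+3) (k`!%:R^-1 : rat)%:P *: A ^+ k.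

Definition plog1p W : PM :=
  \sum_(k < n.+2) ((-1) ^+ k / k.+1%:R : rat)%:P *: W ^+ k.+1.

Definition evalmx (c : rat) : PM -> 'M[rat]_n.+1 := map_mx (horner_eval c).

Definition constmx : 'M[rat]_n.+1 -> PM := map_mx polyC.

Definition doublemx : PM -> PM := map_mx (comp_poly (2%:P * 'X)).

HB.instance Definition _ c := GRing.RMorphism.on (evalmx c).
HB.instance Definition _ := GRing.RMorphism.on constmx.
HB.instance Definition _ := GRing.RMorphism.on doublemx.

Lemma evalmxZ c p A : evalmx c (p *: A) = p.[c] *: evalmx c A.
Proof. by apply/matrixP => i j; rewrite !mxE /horner_eval hornerM. Qed.

Lemma evalmx_const c (a : 'M[rat]_n.+1) : evalmx c (constmx a) = a.
Proof. by apply/matrixP => i j; rewrite !mxE /horner_eval hornerC. Qed.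

Lemma evalmx_double c A : evalmx c (doublemx A) = evalmx (2 * c) A.
Proof.
by apply/matrixP => i j; rewrite !mxE /horner_eval horner_comp !hornerE.
Qed.

(** A path is determined by its values at the natural numbers; identities
    between paths are transported in this way from identities in [u0]. *)
Lemma poly_natP (p : {poly rat}) : (forall c : nat, p.[c%:R] = 0) -> p = 0.
Proof.
move=> h; apply/eqP; apply: contraT => p0.
have := max_poly_roots p0 (rs := [seq k%:R | k <- iota 0 (size p)]).
rewrite size_map size_iota ltnn; apply.
  by apply/allP => _ /mapP[k _ ->]; apply/rootP.
by rewrite map_inj_uniq ?iota_uniq//; apply: mulrIn; rewrite oner_neq0.
Qed.

Lemma evalmx_inj A B : (forall c : nat, evalmx c%:R A = evalmx c%:R B) -> A = B.
Proof.
move=> h; apply/matrixP => i j; apply/eqP; rewrite -subr_eq0; apply/eqP.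
apply: poly_natP => c; have := congr1 (fun M : 'M_n.+1 => M i j) (h c).
by rewrite !mxE /horner_eval hornerD hornerN => ->; rewrite subrr.
Qed.

Lemma evalmx_exp c A : evalmx c A \in strict_upper n.+1 ->
  evalmx c (pexp A) = expmx (evalmx c A).
Proof.
move=> h; have z k : evalmx c A ^+ (n.+1 + k) = 0.
  by rewrite exprD strict_upper_nilp ?mul0r.
rewrite /pexp -[n.+3](addn2 n.+1) big_split_ord rmorphD/= !rmorph_sum/=.
rewrite [X in _ + X]big1 ?addr0 => [|k _]; last first.
  by rewrite evalmxZ rmorphXn z scaler0.
by apply: eq_bigr => k _; rewrite evalmxZ rmorphXn hornerC.
Qed.

Lemma evalmx_log c W : evalmx c W \in strict_upper n.+1 ->
  evalmx c (plog1p W) = logmx (1 + evalmx c W).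
Proof.
move=> h; have z k : evalmx c W ^+ (n.+1 + k) = 0.
  by rewrite exprD strict_upper_nilp ?mul0r.
rewrite /plog1p -[n.+2](addn2 n) big_split_ord rmorphD/= !rmorph_sum/=.
rewrite [X in _ + X]big1 ?addr0 => [|k _]; last first.
  by rewrite evalmxZ rmorphXn -[(n + k).+1]addSn z scaler0.
rewrite /logmx big_add1 big_mkord; apply: eq_bigr => k _ /=.
by rewrite [1 + _]addrC addrK evalmxZ rmorphXn hornerC !exprS mulrA mulrNN mulr1 mul1r.
Qed.

Section Congruence.

(** Congruence of paths modulo [t ^ l]. *)
Definition eqt l A B := exists C, A = B + 'X^l *: C.

Lemma eqt_refl l A : eqt l A A.
Proof. by exists 0; rewrite scaler0 addr0. Qed.

Lemma eqt_trans l B A C : eqt l A B -> eqt l B C -> eqt l A C.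
Proof.
by move=> [D ->] [E ->]; exists (E + D); rewrite scalerDr addrA.
Qed.

Lemma eqt_le l l' A B : (l' <= l)%N -> eqt l A B -> eqt l' A B.
Proof.
move=> /subnKC e [C ->]; exists ('X^(l - l') *: C).
by rewrite scalerA -exprD e.
Qed.

Lemma eqtD l A A' B B' : eqt l A A' -> eqt l B B' -> eqt l (A + B) (A' + B').
Proof.
by move=> [C ->] [D ->]; exists (C + D); rewrite scalerDr addrACA.
Qed.

Lemma eqtD0 l A B : eqt l A 0 -> eqt l B 0 -> eqt l (A + B) 0.
Proof. by move=> hA hB; rewrite -[0]addr0; apply: eqtD. Qed.

Lemma eqtN l A A' : eqt l A A' -> eqt l (- A) (- A').
Proof. by move=> [C ->]; exists (- C); rewrite scalerN opprD. Qed.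

Lemma eqtB_0 l A B : eqt l A 0 -> eqt l B 0 -> eqt l (A - B) 0.
Proof. by move=> hA hB; rewrite -[0](subr0 0); apply: eqtD => //; apply: eqtN. Qed.

Lemma eqtZ l p A B : eqt l A B -> eqt l (p *: A) (p *: B).
Proof. by move=> [C ->]; exists (p *: C); rewrite scalerDr !scalerA mulrC. Qed.

Lemma eqtM0 a b A B : eqt a A 0 -> eqt b B 0 -> eqt (a + b) (A * B) 0.
Proof.
move=> [C ->] [D ->]; exists (C * D).
by rewrite !add0r -scalerAl -scalerAr scalerA exprD.
Qed.

Lemma eqt0X l C : eqt l ('X^l *: C) 0.
Proof. by exists C; rewrite add0r. Qed.

Lemma eqt0 l A B : eqt l (A - B) 0 -> eqt l A B.
Proof. by move=> [C]; rewrite add0r => e; exists C; rewrite -e addrC subrK. Qed.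

Lemma eqtB0 l A B : eqt l A B -> eqt l (A - B) 0.
Proof. by move=> [C ->]; exists C; rewrite add0r addrC addKr. Qed.

Lemma eqt_any A : eqt 0 A 0.
Proof. by exists A; rewrite expr0 scale1r add0r. Qed.

Lemma eqtM l A A' B B' : eqt l A A' -> eqt l B B' -> eqt l (A * B) (A' * B').
Proof.
move=> /eqtB0 h /eqtB0 h'; apply: eqt0.
have -> : A * B - A' * B' = (A - A') * B + A' * (B - B').
  by rewrite mulrBl mulrBr addrA subrK.
rewrite -[0]addr0; apply: eqtD; last exact: (eqtM0 (eqt_any _) h').
by rewrite -[l]addn0; apply: (eqtM0 h (eqt_any _)).
Qed.

Lemma eqtXn l k A B : eqt l A B -> eqt l (A ^+ k) (B ^+ k).
Proof.
move=> h; elim: k => [|k IH]; first by rewrite !expr0; exact: eqt_refl.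
by rewrite !exprS; apply: eqtM.
Qed.

Lemma eqt_sum l m (F G : 'I_m -> PM) :
  (forall i, eqt l (F i) (G i)) -> eqt l (\sum_(i < m) F i) (\sum_(i < m) G i).
Proof.
move=> h; elim/big_ind2: _ => [|????|i _]; [exact: eqt_refl|exact: eqtD|exact: h].
Qed.

Lemma eqt_exp l A B : eqt l A B -> eqt l (pexp A) (pexp B).
Proof. by move=> h; apply: eqt_sum => i; apply: eqtZ; apply: eqtXn. Qed.

Lemma eqt_log l A B : eqt l A B -> eqt l (plog1p A) (plog1p B).
Proof. by move=> h; apply: eqt_sum => i; apply: eqtZ; apply: eqtXn. Qed.

Lemma pexpE A : pexp A =
  1 + A + \sum_(k < n.+1) (k.+2`!%:R^-1 : rat)%:P *: A ^+ k.+2.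
Proof.
rewrite /pexp 2!big_ord_recl /bump /= addrA; congr (_ + _ + _).
- by rewrite invr1 expr0 scale1r.
- by rewrite invr1 expr1 scale1r.
Qed.

(** To first order the exponential adds a perturbation of its argument: in the
    powers above the first one, each term that contains the perturbation has
    another factor divisible by [t]. *)
Lemma eqt_exp1 l A C : (0 < l)%N -> eqt 1 A 0 ->
  eqt l.+1 (pexp (A + 'X^l *: C)) (pexp A + 'X^l *: C).
Proof.
move=> l0 A0; set E := 'X^l *: C; have E0 : eqt l E 0 by exact: eqt0X.
have D0 : eqt 1 (A + E) 0.
  by apply: eqtD0 => //; exact: eqt_le E0.
have p2 k : eqt l.+1 ((A + E) ^+ k.+2) (A ^+ k.+2).
  elim: k => [|k IH].
    apply: eqt0; have -> : (A + E) ^+ 2 - A ^+ 2 = (A + E) * E + E * A.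
      apply/eqP; rewrite !expr2 mulrDr (mulrDl A E A) subr_eq.
      by rewrite addrC [A * A + _]addrC addrA.
    apply: eqtD0; first exact: (eqtM0 D0 E0).
    by have := eqtM0 E0 A0; rewrite addn1.
  rewrite exprS [X in eqt _ _ X]exprS.
  apply: (@eqt_trans _ ((A + E) * A ^+ k.+2)).
    by apply: eqtM => //; exact: eqt_refl.
  rewrite mulrDl -[X in eqt _ _ X]addr0; apply: eqtD; first exact: eqt_refl.
  rewrite -addn1 exprS mulrA -[(l + 1)%N]addn0; apply: eqtM0; last exact: eqt_any.
  exact: eqtM0.
rewrite !pexpE -!addrA; apply: eqtD; first exact: eqt_refl.
apply: eqtD; first exact: eqt_refl.
rewrite addrC; apply: eqtD; last exact: eqt_refl.
by apply: eqt_sum => k; apply: eqtZ; exact: p2.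
Qed.

Lemma eqt_sum0 l m (F : 'I_m -> PM) :
  (forall i, eqt l (F i) 0) -> eqt l (\sum_(i < m) F i) 0.
Proof.
by move=> h; elim/big_ind: _ => [|????|i _]; [exact: eqt_refl|exact: eqtD0|exact: h].
Qed.

Lemma eqtZ0 l p A : eqt l A 0 -> eqt l (p *: A) 0.
Proof. by move=> h; rewrite -[0](scaler0 _ p); apply: eqtZ. Qed.

Lemma eqt_exp0 A : eqt 1 A 0 -> eqt 1 (pexp A) 1.
Proof.
move=> A0; rewrite pexpE -addrA -[X in eqt _ _ X]addr0; apply: eqtD; first exact: eqt_refl.
apply: eqtD0 => //; apply: eqt_sum0 => k; apply: eqtZ0; rewrite exprS.
exact: (eqtM0 A0 (eqt_any _)).
Qed.

(** Each power of [W] above the first vanishes at least to twice the order of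
    [W], which is a gain of at least one. *)
Lemma eqt_log1 l W : eqt l.+1 W 0 -> eqt l.+2 (plog1p W) W.
Proof.
move=> W0; rewrite /plog1p big_ord_recl/= expr0 divr1 expr1 scale1r.
rewrite -[X in eqt _ _ X]addr0; apply: eqtD; first exact: eqt_refl.
apply: eqt_sum0 => k; apply: eqtZ0.
rewrite exprS exprS mulrA -[l.+2]addn0; apply: eqtM0; last exact: eqt_any.
by apply: (@eqt_le (l.+1 + l.+1)); [rewrite addSn ltnS leq_addl|exact: eqtM0].
Qed.

End Congruence.
End PolynomialPaths.

(** * Graded triangular matrices *)

Section Graded.
Variables (R : comNzRingType) (phi : nat -> R -> Prop).
Hypothesis phi0 : forall k, phi k 0.
Hypothesis phi1 : phi 0 1.
Hypothesis phiD : forall k a b, phi k a -> phi k b -> phi k (a + b).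
Hypothesis phiM : forall k l a b, phi k a -> phi l b -> phi (k + l) (a * b).

(** The filtrations used below are the degree of polynomials and the powers of
    a denominator. *)
Definition graded m (A : 'M[R]_m) := forall i j : 'I_m,
  if (i <= j)%N then phi (j - i) (A i j) else A i j = 0.

Lemma gradedD m (A B : 'M[R]_m) : graded A -> graded B -> graded (A + B).
Proof.
move=> hA hB i j; rewrite mxE; have := hA i j; have := hB i j.
by case: leqP => _ => [hb ha|-> ->]; [exact: phiD|rewrite addr0].
Qed.

Lemma graded0 m : graded (0 : 'M[R]_m).
Proof. by move=> i j; rewrite mxE; case: leqP. Qed.

Lemma graded1 m : graded (1 : 'M[R]_m).
Proof.
move=> i j; rewrite mxE; case: (leqP i j) => [ij|ji]; last first.
  by rewrite (_ : i == j = false)//; apply/negbTE/eqP => e; rewrite e ltnn in ji.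
by case: eqP => [->|_]; [rewrite subnn|exact: phi0].
Qed.

Lemma gradedM m (A B : 'M[R]_m) : graded A -> graded B -> graded (A * B).
Proof.
move=> hA hB i j; rewrite mxE; case: leqP => [ij|ji].
  elim/big_ind: _ => [//||k _]; first exact: phiD.
  have := hA i k; have := hB k j; case: leqP => [kj|_ ->]; last by rewrite mulr0.
  case: leqP => [ik|_ _ ->]; last by rewrite mul0r.
  move=> hb ha; rewrite (_ : (j - i)%N = ((k - i) + (j - k))%N); first exact: phiM.
  by rewrite addnC addnBA// subnK.
rewrite big1// => k _; have := hA i k; have := hB k j.
case: leqP => [kj|_ ->]; last by rewrite mulr0.
by case: leqP => [ik|_ _ ->]; [rewrite leqNgt (leq_ltn_trans kj)// in ik|rewrite mul0r].
Qed.

Lemma gradedX m (A : 'M[R]_m) k : graded A -> graded (A ^+ k).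
Proof.
move=> hA; elim: k => [|k IH]; first by rewrite expr0; exact: graded1.
by rewrite exprS; apply: gradedM.
Qed.

Lemma gradedZ m a (A : 'M[R]_m) : phi 0 a -> graded A -> graded (a *: A).
Proof.
move=> ha hA i j; rewrite mxE; have := hA i j; case: leqP => [_ h|_ ->].
  by rewrite -[X in phi X _]add0n; apply: phiM.
by rewrite mulr0.
Qed.

Lemma graded_sum m k (F : 'I_k -> 'M[R]_m) :
  (forall i, graded (F i)) -> graded (\sum_(i < k) F i).
Proof.
by move=> h; elim/big_ind: _ => [|????|i _]; [exact: graded0|exact: gradedD|exact: h].
Qed.

End Graded.

Definition size_filtration (k : nat) (p : {poly rat}) : Prop := (size p <= k.+1)%N.

(** For a path of matrices the entry (i, j) has degree at most j - i; in
    particular the degree of the path is below the size of the matrices. *)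
Local Notation gpath := (graded size_filtration).

Section GradedPaths.
Variable n : nat.
Local Notation PM := 'M[{poly rat}]_n.+1.
Implicit Types A B C P W : PM.
Local Notation szf := size_filtration.

Let sz0 k : szf k 0. Proof. by rewrite /szf size_poly0. Qed.
Let szC k a : szf k a%:P.
Proof. by rewrite /szf; apply: leq_trans (size_polyC_leq1 _) _. Qed.
Let sz1 : szf 0 1. Proof. exact: szC. Qed.
Let szD k p q : szf k p -> szf k q -> szf k (p + q).
Proof.
by move=> hp hq; apply: leq_trans (size_polyD _ _) _; rewrite geq_max hp.
Qed.
Let szM k l p q : szf k p -> szf l q -> szf (k + l) (p * q).
Proof.
rewrite /szf => hp hq; apply: leq_trans (size_polyMleq _ _) _.
by move: hp hq; lia.
Qed.

Lemma gpathD A B : gpath A -> gpath B -> gpath (A + B). Proof. exact: gradedD. Qed.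
Lemma gpathM A B : gpath A -> gpath B -> gpath (A * B). Proof. exact: gradedM. Qed.
Lemma gpathC a A : gpath A -> gpath (a%:P *: A). Proof. exact: gradedZ. Qed.
Lemma gpathN A : gpath A -> gpath (- A).
Proof. by move=> h; rewrite -scaleN1r -[-1]polyCN; apply: gpathC. Qed.

Lemma gpath_exp A : gpath A -> gpath (pexp A).
Proof. by move=> h; apply: graded_sum => // k; apply: gpathC; apply: gradedX. Qed.

Lemma gpath_log A : gpath A -> gpath (plog1p A).
Proof. by move=> h; apply: graded_sum => // k; apply: gpathC; apply: gradedX. Qed.

Lemma gpath1 : gpath (1 : PM). Proof. exact: graded1. Qed.

Lemma gpath_double A : gpath A -> gpath (doublemx A).
Proof.
move=> h i j; have := h i j; rewrite !mxE; case: leqP => [_|_ ->]; last by rewrite comp_poly0.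
rewrite /szf size_comp_poly2// size_Cmul ?size_polyX//.
Qed.

Lemma gpath_const (x : 'M[rat]_n.+1) : x \in strict_upper n.+1 -> gpath (constmx x).
Proof.
move=> /strict_upperP h i j; rewrite mxE; case: leqP => [_|ji] //.
by rewrite h ?(ltnW ji)// polyC0.
Qed.

Lemma gpath_line (x : 'M[rat]_n.+1) : x \in strict_upper n.+1 -> gpath ('X *: constmx x).
Proof.
move=> /strict_upperP h i j; rewrite !mxE; case: leqP => [|ji]; last first.
  by rewrite h ?(ltnW ji)// mulr0.
rewrite leq_eqVlt => /orP[/eqP/val_inj ->|ij].
  by rewrite (h j j (leqnn _)) polyC0 mulr0; exact: sz0.
rewrite /szf mulrC; apply: leq_trans (size_polyMleq _ _) _.
rewrite size_polyX; apply: (leq_trans (n := 2)); last by rewrite ltnS subn_gt0.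
have := size_polyC_leq1 (x i j); case: (size _) => [|[|]]//.
Qed.

(** Since the degree of a graded path is at most [n], congruence to a line
    modulo a high power of [t] is equality. *)
Lemma gpath_line_eq P (x : 'M[rat]_n.+1) : gpath P -> x \in strict_upper n.+1 ->
  eqt n.+2 P ('X *: constmx x) -> P = 'X *: constmx x.
Proof.
move=> hP hx [C e]; have hL := gpath_line hx; apply/matrixP => i j.
have eij : P i j = ('X *: constmx x) i j + 'X^(n.+2) * C i j by rewrite e !mxE.
have sz (A : PM) k : gpath A -> (n.+2 <= k)%N -> (A i j)`_k = 0.
  move=> hA nk; have := hA i j; case: leqP => [ij h|_ ->]; last by rewrite coef0.
  apply: nth_default; apply: leq_trans h (leq_trans _ nk).
  by have := ltn_ord j; lia.
apply/polyP => k; case: (ltnP k n.+2) => kn; last by rewrite !sz.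
by rewrite eij coefD coefXnM kn addr0.
Qed.

Lemma eqt_double C : eqt 1 (doublemx C) C.
Proof.
exists (\matrix_(i, j) drop_poly 1 ((C i j) \Po (2%:P * 'X) - C i j)).
apply/matrixP => i j; rewrite !mxE; set p := C i j.
apply/eqP; rewrite addrC -subr_eq; apply/eqP.
set q := _ - _; rewrite -[LHS](poly_take_drop 1) mulrC -[RHS]add0r; congr (_ + _).
apply/polyP => -[|k]; rewrite coef_take_poly coef0//= /q coefB.
by rewrite mul_polyC coef_comp_scaleX expr0 mulr1 subrr.
Qed.

Lemma doublemxZ p A : doublemx (p *: A) = (p \Po (2%:P * 'X)) *: doublemx A.
Proof. by apply/matrixP => i j; rewrite !mxE comp_polyM. Qed.

Lemma doublemx_const (x : 'M[rat]_n.+1) : doublemx (constmx x) = constmx x.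
Proof. by apply/matrixP => i j; rewrite !mxE comp_polyC. Qed.

End GradedPaths.

(** * Multiples of sums as group words *)

(** The path [c |-> sumword k (c x) (c y)] is a multiple of [t (x + y)] up to an
    error of order [t ^ (k + 2)].  Richardson extrapolation removes the leading
    error term: running the path at double speed multiplies that term by
    [2 ^ (k + 2)] and the linear term by 2 only, so the quotient of that
    power of the path by the path at double speed keeps a multiple of the linear
    term. *)
Fixpoint sumword (gT : groupType) k (x y : gT) : gT :=
  if k is k'.+1 then
    (sumword k' x y ^+ (2 ^ k.+1) * (sumword k' (x ^+ 2) (y ^+ 2))^-1)%g
  else (x * y)%g.

(** The multiple of [x + y] that survives the extrapolation steps. *)
Fixpoint sumcoef k : nat :=
  if k is k'.+1 then ((2 ^ k.+1 - 2) * sumcoef k')%N else 1%N.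

Lemma sumwordS (gT : groupType) k (x y : gT) : sumword k.+1 x y =
  (sumword k x y ^+ (2 ^ k.+2) * (sumword k (x ^+ 2) (y ^+ 2))^-1)%g.
Proof. by []. Qed.

Lemma sumcoefS k : sumcoef k.+1 = ((2 ^ k.+2 - 2) * sumcoef k)%N.
Proof. by []. Qed.

Lemma sumcoef_gt0 k : (0 < sumcoef k)%N.
Proof.
elim: k => // k IH; rewrite sumcoefS muln_gt0 IH andbT subn_gt0.
by rewrite -{1}[2%N]expn1 ltn_exp2l.
Qed.

Lemma pexp_line n (a : 'M[rat]_n.+1) :
  eqt 2 (pexp ('X *: constmx a)) (1 + 'X *: constmx a).
Proof.
have /(_ (constmx a)) := @eqt_exp1 n 1 0 _ isT (eqt_refl _ _).
rewrite expr1 add0r => /eqt_trans; apply; apply: eqtD; last exact: eqt_refl.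
rewrite pexpE addr0 big1 ?addr0; first exact: eqt_refl.
by move=> k _; rewrite expr0n scaler0.
Qed.

Section SumWord.
Variable n : nat.
Implicit Types x y : u0 n.+1.

Let eval_bch A B (x y : u0 n.+1) c : evalmx c A = val x -> evalmx c B = val y ->
  evalmx c (plog1p (pexp A * pexp B - 1)) = val (x * y)%g.
Proof.
move=> hA hB; have sx : val x \in strict_upper n.+1 := valP x.
have sy : val y \in strict_upper n.+1 := valP y.
have e : evalmx c (pexp A * pexp B - 1) = expmx (val x) * expmx (val y) - 1.
  by rewrite rmorphB rmorphM rmorph1/= !evalmx_exp ?hA ?hB.
rewrite evalmx_log e; last exact: strict_upper_expM.
by rewrite addrC subrK.
Qed.

Let gpath_bch A B : gpath A -> gpath B ->
  gpath (plog1p (pexp A * pexp B - 1) : 'M[{poly rat}]_n.+1).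
Proof.
move=> hA hB; apply: gpath_log; apply: gpathD; last by apply: gpathN; exact: gpath1.
by apply: gpathM; exact: gpath_exp.
Qed.

Let val_invg (z : u0 n.+1) : val (z^-1)%g = - val z.
Proof. exact: (raddfN val z). Qed.

Let line (s : u0 n.+1) : 'M[{poly rat}]_n.+1 := 'X *: constmx (val s).

Let eval_line s c : evalmx c%:R (line s) = val (s *+ c).
Proof. by rewrite /line evalmxZ hornerX evalmx_const val_mulrn. Qed.

Let eval_lineZ s a c : evalmx c%:R (a%:R%:P *: line s) = val (s *+ (a * c)).
Proof.
by rewrite evalmxZ hornerC eval_line !val_mulrn scalerA natrM.
Qed.

Let line0 p s : eqt 1 (p *: line s) 0.
Proof. by apply: eqtZ0; rewrite /line -['X]expr1; exact: eqt0X. Qed.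

Definition bchpath x y : 'M[{poly rat}]_n.+1 :=
  plog1p (pexp ('X *: constmx (val x)) * pexp ('X *: constmx (val y)) - 1).

Lemma bchpathP x y : [/\ gpath (bchpath x y),
    forall c : nat, evalmx c%:R (bchpath x y) = val ((x *+ c)%R * (y *+ c)%R)%g
  & eqt 2 (bchpath x y) ('X *: constmx (val x + val y))].
Proof.
rewrite /bchpath -/(line x) -/(line y); split.
- by apply: gpath_bch; apply: gpath_line; exact: valP.
- by move=> c; apply: eval_bch; exact: eval_line.
have e s : eqt 2 (pexp (line s)) (1 + line s) := pexp_line (val s).
have xy : eqt 2 (line x * line y) 0.
  by apply: (@eqtM0 _ 1 1); rewrite -[X in eqt _ X _]scale1r.
have W : eqt 2 (pexp (line x) * pexp (line y) - 1) (line x + line y).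
  apply: (@eqt_trans _ _ ((1 + line x) * (1 + line y) - 1)).
    by apply: eqtD; [apply: eqtM|exact: eqt_refl].
  have -> : (1 + line x) * (1 + line y) - 1 = line x + line y + line x * line y.
    by rewrite mulrDl mul1r mulrDr mulr1 -addrA addrC addrA subrK addrAC.
  by rewrite -[X in eqt _ _ X]addr0; apply: eqtD => //; exact: eqt_refl.
rewrite rmorphD/= scalerDr; apply: eqt_trans (W); apply: eqt_log1.
apply: eqt_trans (eqt_le _ W) _ => //.
by apply: eqtD0; rewrite -[X in eqt _ X _]scale1r.
Qed.

Lemma sumword_path k x y : exists P, [/\ gpath P,
    forall c : nat, evalmx c%:R P = val (sumword k (x *+ c) (y *+ c))
  & eqt k.+2 P ((sumcoef k)%:R%:P *: ('X *: constmx (val (x + y))))].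
Proof.
elim: k => [|k [P [gP eP tP]]].
  by exists (bchpath x y); rewrite scale1r; exact: bchpathP.
set s := x + y in tP *; set a := sumcoef k in tP *.
have [N eN] : exists N, N = (2 ^ k.+2)%N by exists (2 ^ k.+2)%N.
exists (plog1p (pexp (N%:R%:P *: P) * pexp (- doublemx P) - 1)); split.
- apply: gpath_bch; first exact: gpathC.
  by apply: gpathN; exact: gpath_double.
- move=> c; rewrite sumwordS -eN; apply: eval_bch.
    by rewrite evalmxZ hornerC eP expgE_mulrn val_mulrn.
  rewrite rmorphN/= evalmx_double -natrM eP !expgE_mulrn -!mulrnA.
  by rewrite [(c * 2)%N]mulnC -val_invg.
have [C eC] := tP.
(* The error term [t ^ (k + 2) C] is multiplied by [N = 2 ^ (k + 2)] both
   when the speed is doubled and in the N-th power of the path. *)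
have dP : eqt k.+3 (doublemx P) ((2 * a)%:R%:P *: line s + 'X^(k.+2) *: (N%:R%:P *: C)).
  rewrite eC rmorphD/= !doublemxZ doublemx_const comp_polyC comp_polyX.
  rewrite comp_Xn_poly exprMn -rmorphXn/= -natrX -eN; apply: eqtD.
    by rewrite natrM polyCM !scalerA [_%:P * _%:P]mulrC mulrA; exact: eqt_refl.
  have [E ->] := eqt_double C; exists (N%:R%:P *: E).
  rewrite !(scalerDr, scalerA) [N%:R%:P * _]mulrC; congr (_ + _ *: _).
  by rewrite mulrAC -exprSr.
have NP : N%:R%:P *: P = (N * a)%:R%:P *: line s + 'X^(k.+2) *: (N%:R%:P *: C).
  rewrite eC scalerDr; congr (_ + _).
    by rewrite natrM polyCM [in RHS]mulrC !scalerA mulrA [_ * N%:R%:P]mulrC.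
  by rewrite !scalerA mulrC.
set A := (N * a)%:R%:P *: line s in NP *.
set B := - ((2 * a)%:R%:P *: line s).
set D := 'X^(k.+2) *: (N%:R%:P *: C) in dP NP *.
have A0 : eqt 1 A 0 by exact: line0.
have B0 : eqt 1 B 0 by rewrite /B -scaleNr; exact: line0.
have eA : eqt k.+3 (pexp (N%:R%:P *: P)) (pexp A + D) by rewrite NP; exact: eqt_exp1.
have eB : eqt k.+3 (pexp (- doublemx P)) (pexp B - D).
  apply: (@eqt_trans _ _ (pexp (B - D))).
    by apply: eqt_exp; rewrite -opprD; apply: eqtN.
  rewrite -scalerN; exact: eqt_exp1.
have eAB : eqt k.+3 (pexp (N%:R%:P *: P) * pexp (- doublemx P)) (pexp A * pexp B).
  apply: eqt_trans (eqtM eA eB) _; apply: eqt0.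
  have -> : (pexp A + D) * (pexp B - D) - pexp A * pexp B =
      D * (pexp B - 1) - (pexp A - 1) * D - D * D.
    rewrite mulrDl [D * (_ - 1)]mulrBr mulr1 [(_ - 1) * D]mulrBl mul1r.
    rewrite [pexp A * (_ - _)]mulrBr [D * (_ - _)]mulrBr.
    rewrite addrAC [pexp A * pexp B - _]addrC addrK opprB [in RHS]addrA subrK.
    by rewrite addrA [- _ + _]addrC.
  have D0 : eqt k.+2 D 0 by exact: eqt0X.
  apply: eqtB_0; first apply: eqtB_0.
  - rewrite -[k.+3]addn1; apply: eqtM0 => //; apply: eqtB0; exact: eqt_exp0.
  - rewrite -[k.+3]add1n; apply: eqtM0 => //; apply: eqtB0; exact: eqt_exp0.
  - apply: (@eqt_le _ (k.+2 + k.+2)); last exact: eqtM0.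
    by rewrite addSn ltnS addnS ltnS leq_addl.
have -> : (sumcoef k.+1)%:R%:P *: ('X *: constmx (val s)) = plog1p (pexp A * pexp B - 1).
  apply: evalmx_inj => c; rewrite eval_lineZ.
  rewrite (eval_bch (eval_lineZ _ _ _) (y := (s *+ (2 * a * c))^-1%g)); last first.
    by rewrite rmorphN/= eval_lineZ -val_invg.
  congr val; rewrite -!expgE_mulrn sumcoefS -eN -mulnA mulnBl -!mulnA -/a.
  by apply: expgnFr; rewrite leq_mul2r eN -{1}[2%N]expn1 leq_exp2l ?orbT.
by apply: eqt_log; apply: eqtD => //; exact: eqt_refl.
Qed.

End SumWord.

(** After [n] steps the error term has order above the degree of the path, so
    it vanishes. *)
Lemma sumwordE n (x y : u0 n) : sumword n x y = (x + y) *+ sumcoef n.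
Proof.
apply: val_inj; case: n x y => [|n] x y; first by rewrite [LHS]flatmx0 [RHS]flatmx0.
have [P [gP eP tP]] := sumword_path n.+1 x y.
set s := val (x + y) in tP; set a := sumcoef n.+1 in tP *.
have as_ : a%:R *: s \in strict_upper n.+1.
  by apply: strict_upperZ; exact: (valP (x + y)).
have /(gpath_line_eq gP as_) e : eqt n.+2 P ('X *: constmx (a%:R *: s)).
  apply: eqt_le (eqt_trans tP _) => //.
  rewrite (_ : constmx (a%:R *: s) = a%:R%:P *: constmx s).
    by rewrite !scalerA [_ * 'X]mulrC; exact: eqt_refl.
  by apply/matrixP => i j; rewrite !mxE polyCM.
have := eP 1%N; rewrite e evalmxZ hornerX scale1r evalmx_const => <-.
by rewrite val_mulrn.
Qed.

(** * Subgroups and homomorphisms *)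

Section Subgroups.
Variable n : nat.
Implicit Types (G N : set (u0 n)).

Lemma subgroupMn (gT : groupType) (G : set gT) (x : gT) k :
  subgroup G -> G x -> G (x ^+ k)%g.
Proof.
move=> [G1 GM _] Gx; elim: k => [//|k IH]; rewrite expgS; exact: GM.
Qed.

Lemma subgroup_mulrn G (x : u0 n) k : subgroup G -> G x -> G (x *+ k).
Proof. by rewrite -expgE_mulrn; exact: subgroupMn. Qed.

Lemma subgroup_opp G (x : u0 n) : subgroup G -> G x -> G (- x).
Proof. by case=> _ _; exact. Qed.

Lemma subgroup_mulrz G (x : u0 n) (z : int) : subgroup G -> G x -> G (x *~ z).
Proof.
move=> sG Gx; case: z => k; first exact: subgroup_mulrn.
by rewrite NegzE mulrNz; apply: subgroup_opp => //; exact: subgroup_mulrn.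
Qed.

Lemma subgroup_sumword (gT : groupType) (G : set gT) k (x y : gT) :
  subgroup G -> G x -> G y -> G (sumword k x y).
Proof.
move=> sG; case: (sG) => _ GM GV.
elim: k x y => [|k IH] x y Gx Gy; first exact: GM.
rewrite sumwordS; apply: GM; first by apply: subgroupMn => //; exact: IH.
by apply: GV; apply: IH; exact: subgroupMn.
Qed.

(** Being a word, the combination above is respected by homomorphisms that are
    defined on a subgroup only; through it they are linear up to a factor. *)
Section Hom.
Variables (gT rT : groupType) (G : set gT) (f : gT -> rT).
Hypothesis sG : subgroup G.
Hypothesis fM : forall x y, G x -> G y -> f (x * y)%g = (f x * f y)%g.

Lemma hom1 : f 1%g = 1%g.
Proof.
have [G1 _ _] := sG; have := fM G1 G1; rewrite mulg1 => e.
by apply: (@mulgI _ (f 1%g)); rewrite -e mulg1.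
Qed.

Lemma homV x : G x -> f x^-1%g = (f x)^-1%g.
Proof.
move=> Gx; have [_ _ GV] := sG; apply: (@mulgI _ (f x)).
by rewrite -fM ?mulgV ?hom1//; exact: GV.
Qed.

Lemma homX x k : G x -> f (x ^+ k)%g = (f x ^+ k)%g.
Proof.
move=> Gx; elim: k => [|k IH]; first exact: hom1.
by rewrite !expgS fM ?IH//; exact: subgroupMn.
Qed.

Lemma hom_sumword k x y : G x -> G y -> f (sumword k x y) = sumword k (f x) (f y).
Proof.
elim: k x y => [|k IH] x y Gx Gy; first exact: fM.
have GX m z : G z -> G (z ^+ m)%g by exact: subgroupMn.
have GS u v : G u -> G v -> G (sumword k u v) by exact: subgroup_sumword.
have [_ _ GV] := sG.
by rewrite !sumwordS fM ?homV ?homX ?IH ?homX//; auto.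
Qed.

End Hom.

Lemma subgroup_mulrD G (x y : u0 n) : subgroup G -> G x -> G y ->
  G ((x + y) *+ sumcoef n).
Proof. by move=> *; rewrite -sumwordE; exact: subgroup_sumword. Qed.

Lemma hom_mulrD G (x y : u0 n) (f : u0 n -> u0 n) : subgroup G ->
  (forall u v, G u -> G v -> f (u * v)%g = (f u * f v)%g) -> G x -> G y ->
  f ((x + y) *+ sumcoef n) = (f x + f y) *+ sumcoef n.
Proof. by move=> sG fM Gx Gy; rewrite -!sumwordE (hom_sumword sG). Qed.

(** The factor depends only on the number of terms and the size of the
    matrices; this uniformity is what bounds indices later on. *)
Lemma subgroup_mulr_sum G (s : seq (u0 n)) : subgroup G ->
  {in s, forall x, G x} -> G ((\sum_(x <- s) x) *+ sumcoef n ^ size s).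
Proof.
move=> sG; elim: s => [|x s IH] h; first by rewrite big_nil; case: sG.
have hs : G ((\sum_(x <- s) x) *+ sumcoef n ^ size s).
  by apply: IH => y ys; apply: h; rewrite inE ys orbT.
have hx : G (x *+ sumcoef n ^ size s).
  by apply: subgroup_mulrn => //; apply: h; rewrite mem_head.
rewrite big_cons expnSr mulrnA mulrnDl.
exact: subgroup_mulrD.
Qed.

End Subgroups.

(** * Interpolation of conjugates *)

Lemma common_denominator (I : finType) (F : I -> rat) :
  exists2 M : nat, (0 < M)%N & exists a : I -> int, forall i, M%:R * F i = (a i)%:~R.
Proof.
exists (\prod_(i : I) `|denq (F i)|)%N.
  by apply: prodn_gt0 => i; rewrite absz_gt0 denq_neq0.
exists (fun i => (\prod_(j | j != i) `|denq (F j)|)%N%:Z * numq (F i)) => i.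
rewrite (bigD1 i)//= mulnC natrM -mulrA rmorphM/= -pmulrn; congr (_ * _).
have -> : `|denq (F i)|%N%:R = (denq (F i))%:~R :> rat by rewrite -[in RHS]absz_denq.
by rewrite numqE mulrC.
Qed.

Section ConjugationPath.
Variable n : nat.
Implicit Types x g : u0 n.+1.

Definition conjpath x g : 'M[{poly rat}]_n.+1 :=
  pexp (- ('X *: constmx (val g))) * constmx (val x) * pexp ('X *: constmx (val g)).

Lemma eval_conjpath x g (c : nat) :
  evalmx c%:R (conjpath x g) = val (x ^ (g *+ c)%R)%g.
Proof.
rewrite val_conjg !rmorphM/= evalmx_const.
have sg : val (g *+ c) \in strict_upper n.+1 := valP (g *+ c).
have e : evalmx c%:R ('X *: constmx (val g)) = val (g *+ c).
  by rewrite evalmxZ hornerX evalmx_const val_mulrn.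
by rewrite !evalmx_exp ?rmorphN/= ?e// rpredN.
Qed.

Lemma size_conjpath x g i j : (size (conjpath x g i j) <= n.+1)%N.
Proof.
have : gpath (conjpath x g).
  have gl := gpath_line (valP g).
  apply: gpathM; last exact: gpath_exp.
  apply: gpathM; first by apply: gpath_exp; apply: gpathN.
  by apply: gpath_const; exact: (valP x).
move=> /(_ i j); case: leqP => [_|_ ->]; last by rewrite size_poly0.
move=> /leq_trans; apply; rewrite ltnS; apply: leq_trans (leq_subr _ _) _.
by rewrite -ltnS.
Qed.

Lemma conjpath_tangent x g i j :
  (conjpath x g i j)`_1 = (val x * val g - val g * val x) i j.
Proof.
set X := constmx (val x); set Y := constmx (val g).
have e : eqt 2 (conjpath x g) (X + 'X *: (X * Y - Y * X)).
  have hm : eqt 2 (pexp (- ('X *: Y))) (1 - 'X *: Y).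
    by rewrite -scalerN -rmorphN; exact: pexp_line.
  apply: eqt_trans (eqtM (eqtM hm (eqt_refl _ _)) (pexp_line _)) _.
  rewrite -/Y !(mulrDl, mulrDr, mulr1, mul1r) -/X.
  exists (- (Y * X * Y)).
  rewrite -!(scalerAl, scalerAr) mulNr -!scalerAl mulNr -scalerAl.
  rewrite !scalerN scalerA -expr2 scalerBr -!addrA; congr (_ + _).
  exact: addrCA.
have [C ->] := e; rewrite -rmorphM -rmorphM -rmorphB.
move: (val x * val g - _) => Z; rewrite !mxE !coefD coefC coefXnM coefXM coefC.
by rewrite add0r addr0.
Qed.

(** A polynomial of degree at most n is determined by n.+1 of its values, so
    each linear functional of it is a fixed rational combination of these. *)
Lemma conjpath_interpolation (K : nat) (lam : {poly rat} -> rat) : (0 < K)%N ->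
  (forall p q, lam (p + q) = lam p + lam q) ->
  (forall c p, lam (c%:P * p) = c * lam p) ->
  exists2 M : nat, (0 < M)%N & exists a : 'I_n.+1 -> int, forall x g,
    M%:R *: map_mx lam (conjpath x g) =
      val (\sum_(i < n.+1) ((x ^ (g *+ (K * i))%R)%g : u0 n.+1) *~ a i).
Proof.
move=> K0 lamD lamZ; have lam0 : lam 0 = 0.
  by rewrite -[0](mul0r 0) -polyC0 lamZ mul0r.
pose pt k : rat := (K * k)%:R.
have pt_inj : injective pt.
  move=> k l /eqP; rewrite eqr_nat eqn_pmul2l// => /eqP //.
have [M M0 [a ea]] := common_denominator (fun i => lam (tnth (n.+1.-lagrange pt) i)).
exists M => //; exists a => x g.
apply/matrixP => i j; rewrite [LHS]mxE [X in _ * X]mxE.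
rewrite [X in lam X](lagrange_gen (ltn0Sn n) pt_inj (size_conjpath x g i j)).
rewrite (big_morph lam lamD lam0) mulr_sumr raddf_sum/= summxE.
apply: eq_bigr => k _; rewrite lamZ mulrCA ea val_mulrz -eval_conjpath.
by rewrite !mxE mulrC.
Qed.

End ConjugationPath.

Section Conjugates.
Variable n : nat.

(** Conjugates of [x] by powers of [g ^ K] determine a multiple of the
    conjugate by [g] itself, by interpolation along the line through [g]. *)
Lemma subgroup_conj_multiple (K : nat) : (0 < K)%N ->
  exists2 M : nat, (0 < M)%N & forall (N : set (u0 n)) (x g : u0 n), subgroup N ->
    (forall k, N (x ^ (g *+ (K * k))%R)%g) -> N ((x ^ g)%g *+ M).
Proof.
case: n => [|m] K0.
  exists 1%N => // N x g sN /(_ 0%N); congr N.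
  by apply: val_inj; rewrite [LHS]flatmx0 [RHS]flatmx0.
have [||M M0 [a ea]] := @conjpath_interpolation m K (fun p => p.[1]) K0.
- by move=> p q; rewrite hornerD.
- by move=> c p; rewrite hornerM hornerC.
exists (M * sumcoef m.+1 ^ m.+1)%N => [|N x g sN h].
  by rewrite muln_gt0 M0 expn_gt0 sumcoef_gt0.
pose s := [seq ((x ^ (g *+ (K * nat_of_ord i))%R)%g : u0 m.+1) *~ a i | i <- enum 'I_m.+1].
have es : (x ^ g)%g *+ M = \sum_(y <- s) y.
  apply: val_inj; rewrite /s big_map big_enum -ea val_mulrn; congr (_ *: _).
  have := eval_conjpath x g 1; rewrite mulr1n => <-.
  by apply/matrixP => i j; rewrite !mxE.
have hs : {in s, forall y, N y}.
  by move=> _ /mapP[i _ ->]; apply: subgroup_mulrz.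
have := subgroup_mulr_sum sN hs.
by rewrite -es -mulrnA size_map size_enum_ord.
Qed.

(** The bracket is the linear coefficient of the conjugation along a line, hence
    a rational combination of conjugates. *)
Lemma bracket_conj_sum : exists2 M : nat, (0 < M)%N & forall (G : set (u0 n)) (x g : u0 n),
  subgroup G -> G x -> G g ->
  exists2 s : seq (u0 n), {in s, forall y, G y} & bracket x g *+ M = \sum_(y <- s) y.
Proof.
case: n => [|m].
  exists 1%N => // G x g _ _ _; exists [::] => //.
  by apply: val_inj; rewrite [LHS]flatmx0 [RHS]flatmx0.
have [||M M0 [a ea]] := @conjpath_interpolation m 1 (fun p => p`_1) isT.
- by move=> p q; rewrite coefD.
- by move=> c p; rewrite coefCM.
exists M => // G x g sG Gx Gg.
exists [seq ((x ^ (g *+ (1 * nat_of_ord i))%R)%g : u0 m.+1) *~ a i | i <- enum 'I_m.+1].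
  move=> _ /mapP[i _ ->]; apply: subgroup_mulrz => //; rewrite conjgE.
  case: (sG) => _ GM GV; have Gk := subgroup_mulrn (1 * i) sG Gg.
  by apply: (GM); [exact: GV|exact: GM].
apply: val_inj; rewrite big_map big_enum -ea val_mulrn; congr (_ *: _).
by apply/matrixP => i j; rewrite [RHS]mxE conjpath_tangent.
Qed.

End Conjugates.

(** * The lattice spanned by a subgroup *)

Section Spans.
Variable n : nat.
Implicit Types (G : set (u0 n)) (x y v : u0 n).

(** Sums of lists of elements of [G]: when [G] is a subgroup it is closed under
    negation, so that these are the integral combinations. *)
Definition zspan G : set (u0 n) :=
  [set v | exists2 s : seq (u0 n), {in s, forall x, G x} & v = \sum_(x <- s) x].

Definition qspan G : set (u0 n) := [set v | exists2 k, (0 < k)%N & zspan G (v *+ k)].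

Lemma zspan_sub G x : G x -> zspan G x.
Proof.
by move=> Gx; exists [:: x]; [move=> y; rewrite inE => /eqP->|rewrite big_seq1].
Qed.

Lemma zspan0 G : zspan G 0.
Proof. by exists [::]; rewrite ?big_nil. Qed.

Lemma zspanD G x y : zspan G x -> zspan G y -> zspan G (x + y).
Proof.
move=> [s hs ->] [t ht ->]; exists (s ++ t); last by rewrite big_cat.
by move=> z; rewrite mem_cat => /orP[/hs|/ht].
Qed.

Lemma zspanN G x : subgroup G -> zspan G x -> zspan G (- x).
Proof.
move=> sG [s hs ->]; exists [seq - y | y <- s]; last by rewrite big_map sumrN.
by move=> _ /mapP[y ys ->]; apply: subgroup_opp => //; exact: hs.
Qed.

Lemma zspan_mulrn G x k : zspan G x -> zspan G (x *+ k).
Proof.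
move=> Gx; elim: k => [|k IH]; first by rewrite mulr0n; exact: zspan0.
by rewrite mulrS; apply: zspanD.
Qed.

Lemma zspan_qspan G x : zspan G x -> qspan G x.
Proof. by exists 1%N. Qed.

Lemma qspan_divn G x k : (0 < k)%N -> qspan G (x *+ k) -> qspan G x.
Proof.
move=> k0 [l l0]; rewrite -mulrnA => h.
by exists (k * l)%N => //; rewrite muln_gt0 k0.
Qed.

Lemma qspan_bracket G x y : subgroup G -> G x -> G y -> qspan G (bracket x y).
Proof.
move=> sG Gx Gy; have [M M0 /(_ G x y sG Gx Gy)[s hs e]] := bracket_conj_sum n.
by exists M => //; exists s.
Qed.

Lemma hom_mulrn G (f : u0 n -> u0 n) x k : subgroup G ->
  (forall u v, G u -> G v -> f (u * v)%g = (f u * f v)%g) -> G x ->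
  f (x *+ k) = f x *+ k.
Proof. by move=> sG fM Gx; rewrite -!expgE_mulrn (homX sG fM). Qed.

(** The factor depends on the number of terms, which is harmless for proving
    identities since [u0 n] has no torsion. *)
Lemma hom_sum_multiple G (f : u0 n -> u0 n) (s : seq (u0 n)) : subgroup G ->
  (forall u v, G u -> G v -> f (u * v)%g = (f u * f v)%g) -> {in s, forall x, G x} ->
  f ((\sum_(x <- s) x) *+ sumcoef n ^ size s) =
    (\sum_(x <- s) f x) *+ sumcoef n ^ size s.
Proof.
move=> sG fM; elim: s => [|x s IH] h; first by rewrite !big_nil !mul0rn; exact: (hom1 sG fM).
have ht : {in s, forall x, G x} by move=> y ys; apply: h; rewrite inE ys orbT.
have Gx : G x by apply: h; rewrite mem_head.
have hs := subgroup_mulr_sum sG ht.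
have hx := subgroup_mulrn (sumcoef n ^ size s) sG Gx.
rewrite !big_cons expnSr mulrnA mulrnDl (hom_mulrD sG fM)// IH//.
by rewrite (hom_mulrn _ sG fM)// [RHS]mulrnA [in RHS]mulrnDl.
Qed.

End Spans.

(** * Denominators *)

Local Notation intmx := (mxOver Num.int).

(** Each power of [W] costs a factor [D], so [N] factors suffice whatever [W]
    is. *)
Lemma mxOver_series (R : comNzRingType) (S : subringClosed R) m (W : 'M[R]_m.+1)
    (D F : R) N (c : nat -> R) :
  D \in S -> (forall k : 'I_N, F * c k \in S) -> D *: W \is a mxOver S ->
  (F * D ^+ N) *: (\sum_(k < N) c k *: W ^+ k) \is a mxOver S.
Proof.
move=> hD hc hW; rewrite scaler_sumr; apply: rpred_sum => k _.
have kN : (k <= N)%N by rewrite ltnW.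
have -> : (F * D ^+ N) *: (c k *: W ^+ k) =
    (F * c k * D ^+ (N - k)) *: (D *: W) ^+ k.
  rewrite exprZn !scalerA; congr (_ *: _).
  have -> : D ^+ N = D ^+ (N - k) * D ^+ k by rewrite -exprD subnK.
  by ring.
apply: mxOverZ; first by rewrite rpredM// rpredX.
elim: (k : nat) => [|l IH]; last by rewrite exprS; apply: mxOverM.
by rewrite expr0; apply: mxOver_scalar; rewrite ?rpred0 ?rpred1.
Qed.

Lemma fact_div_int N k : (0 < k)%N -> (k <= N)%N -> (N`!%:R / k%:R : rat) \is a Num.int.
Proof.
move=> k0 kN; have /dvdnP[q ->] : (k %| N`!)%N by rewrite dvdn_fact// k0.
by rewrite natrM mulfK ?pnatr_eq0 -?lt0n// rpred_nat.
Qed.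

Lemma fact_div_fact_int N k : (k <= N)%N -> (N`!%:R / k`!%:R : rat) \is a Num.int.
Proof.
by move=> kN; rewrite -(bin_fact kN) mulnCA natrM mulrC mulKf ?rpred_nat.
Qed.

(** Matrices whose k-th superdiagonal has denominators dividing [d ^ k] are
    stable under products: this is conjugation by the diagonal matrix of the
    powers of [d]. *)
Definition denom_filtration (d k : nat) (q : rat) : Prop := d%:R ^+ k * q \is a Num.int.

Lemma bounded_denominators n (G : set (u0 n)) : finitely_generated G ->
  exists2 d : nat, (0 < d)%N & forall x, G x -> val (x *+ d) \is a intmx.
Proof.
case: n G => [|n] G [S [/finite_seqP[s eS] <-]]; subst S.
  by exists 1%N => // x _; rewrite flatmxOver.
have [d d0 [a ha]] := common_denominator (fun t : 'I_(size s) * bool * ('I_n.+1 * 'I_n.+1) =>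
  expmx ((-1) ^+ t.1.2 *: val (nth 0 s t.1.1)) t.2.1 t.2.2).
pose phi := denom_filtration d.
have phi0 k : phi k 0 by rewrite /phi /denom_filtration mulr0 rpred0.
have phi1 : phi 0%N 1 by rewrite /phi /denom_filtration mulr1 rpred1.
have phiM k l p q : phi k p -> phi l q -> phi (k + l)%N (p * q).
  by move=> hp hq; rewrite /phi /denom_filtration exprD mulrACA rpredM.
have phiD k p q : phi k p -> phi k q -> phi k (p + q).
  by move=> hp hq; rewrite /phi /denom_filtration mulrDr rpredD.
pose B := [set x : u0 n.+1 | graded phi (expmx (val x)) /\ graded phi (expmx (val (- x)))]%classic.
have sB : subgroup B.
  split.
  - have e : graded phi (expmx (val (0 : u0 n.+1))) by rewrite expmx0; exact: graded1.
    by split => //; rewrite oppr0.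
  - move=> x y [hx hx'] [hy hy']; split; first by rewrite expmx_bch; exact: gradedM.
    have -> : - (x * y)%g = (- y * - x)%g :> u0 n.+1 by exact: invgM.
    by rewrite expmx_bch; exact: gradedM.
  - by move=> x [hx hx']; split => //; rewrite opprK.
have BS : ([set` s] `<=` B)%classic.
  have h x (b : bool) : x \in s -> graded phi (expmx ((-1) ^+ b *: val x)).
    move=> xs i j; have hx : (-1) ^+ b *: val x \in strict_upper n.+1.
      by apply: strict_upperZ; exact: (valP x).
    have /strict_upperP hE := strict_upper_exp1 hx.
    have := hE i j; rewrite !mxE; case: (ltnP i j) => [ij _|ji].
      rewrite (ltnW ij) /phi /denom_filtration.
      have xi : (index x s < size s)%N by rewrite index_mem.
      have := ha (Ordinal xi, b, (i, j)); rewrite /= nth_index// => e.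
      rewrite -(subnK (_ : 0 < j - i)%N) ?subn_gt0// addn1 exprSr -mulrA e.
      by rewrite rpredM ?rpredX ?rpred_nat// intr_int.
    move=> /(_ isT)/eqP; rewrite subr_eq0 => /eqP ->.
    have [->|ne] := eqVneq i j; first by rewrite leqnn subnn.
    by rewrite leq_eqVlt ltnNge ji orbF (inj_eq val_inj) (negPf ne).
  move=> x xs; split; first by have := h x false xs; rewrite expr0 scale1r.
  by have := h x true xs; rewrite expr1 scaleN1r raddfN.
pose D := (d ^ n.+1)%N; exists ((n.+1)`! * D ^ n.+1)%N.
  by rewrite muln_gt0 fact_gt0 !expn_gt0 d0.
move=> x /(smallest_sub sB BS)[hx _].
have hW : D%:R *: (expmx (val x) - 1) \is a intmx.
  apply/mxOverP => i j; rewrite 3!mxE mulrBr rpredB//; last first.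
    by rewrite mxE rpredM// rpred_nat.
  have := hx i j; case: leqP => [ij|_ ->]; last by rewrite mulr0 rpred0.
  rewrite /phi /denom_filtration => h; have jn : (j - i <= n.+1)%N.
    by apply: leq_trans (leq_subr _ _) (ltnW _).
  have -> : (D%:R : rat) = d%:R ^+ (n.+1 - (j - i)) * d%:R ^+ (j - i).
    by rewrite -exprD subnK// natrX.
  by rewrite -mulrA rpredM ?rpredX ?rpred_nat.
pose c k : rat := if k is k'.+1 then (-1) ^+ k.+1 / k%:R else 0.
have e : val x = \sum_(k < n.+1) c k *: (expmx (val x) - 1) ^+ k.
  rewrite -[LHS](expmxK (valP x)) /logmx big_add1 big_mkord.
  by rewrite big_ord_recl scale0r add0r.
rewrite val_mulrn e natrM natrX; apply: mxOver_series => //.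
  exact: rpred_nat.
move=> k; rewrite /c; case: (k : nat) (ltn_ord k) => [|l] ln; first by rewrite mulr0 rpred0.
by rewrite mulrCA rpredM ?rpredX ?rpredN1// fact_div_int// ltnW.
Qed.

Definition intpoly : {pred {poly rat}} :=
  fun p => `[< forall i, p`_i \is a Num.int >].

Lemma intpolyP (p : {poly rat}) : reflect (forall i, p`_i \is a Num.int) (p \in intpoly).
Proof. exact: asboolP. Qed.

Lemma intpoly_subring : subring_closed intpoly.
Proof.
split; first by apply/intpolyP => i; rewrite coef1 rpred_nat.
- by move=> p q /intpolyP hp /intpolyP hq; apply/intpolyP => i; rewrite coefB rpredB.
- move=> p q /intpolyP hp /intpolyP hq; apply/intpolyP => i; rewrite coefM.
  by apply: rpred_sum => j _; rewrite rpredM.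
Qed.

HB.instance Definition _ :=
  GRing.isSubringClosed.Build {poly rat} intpoly intpoly_subring.

Lemma intpolyC (c : rat) : (c%:P \in intpoly) = (c \is a Num.int).
Proof.
apply/intpolyP/idP => [/(_ 0%N)|hc i]; rewrite coefC//.
by case: (i == 0%N); rewrite ?rpred0.
Qed.

Lemma intpolyX : 'X \in intpoly.
Proof. by apply/intpolyP => i; rewrite coefX rpred_nat. Qed.

Lemma intpoly_horner (p : {poly rat}) (c : nat) : p \in intpoly -> p.[c%:R] \is a Num.int.
Proof.
move=> /intpolyP hp; rewrite horner_coef; apply: rpred_sum => i _.
by rewrite rpredM// rpredX// rpred_nat.
Qed.

Lemma u0_divn n (w : u0 n) (E q : nat) (A : 'M[rat]_n) : (0 < q)%N ->
  val w *+ E = A *+ q -> exists2 Z : u0 n, val Z = A & w *+ E = Z *+ q.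
Proof.
move=> q0 e; have q0' : q%:R != 0 :> rat by rewrite pnatr_eq0 -lt0n.
have eA : A = (E%:R / q%:R) *: val w.
  by rewrite mulrC -scalerA scaler_nat e -scaler_nat scalerA mulVf// scale1r.
have sA : strict_upper n A by rewrite eA; apply: strict_upperZ; exact: (valP w).
by exists (U0 sA) => //; apply: val_inj; rewrite !raddfMn.
Qed.

(** The path [t |-> tx * ty] is [t (x + y)] modulo [t ^ 2]; for integral [x] and
    [y] its coefficients are integral up to a factor that depends on the size of
    the matrices only. *)
Lemma bch_second_order n : exists2 E : nat, (0 < E)%N & forall (x y : u0 n) (k : nat),
  val x \is a intmx -> val y \is a intmx ->
  exists2 Z : u0 n, val Z \is a intmx &
    (((x *+ k)%R * (y *+ k)%R)%g - (x + y) *+ k) *+ E = Z *+ (k * k).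
Proof.
case: n => [|n].
  exists 1%N => // x y k _ _; exists 0; first by rewrite flatmxOver.
  by apply: val_inj; rewrite [LHS]flatmx0 [RHS]flatmx0.
pose f := (n.+2)`!; pose E := (f * (f * f) ^ n.+3)%N.
have f0 : (0 < f)%N by exact: fact_gt0.
exists E => [|x y k ix iy]; first by rewrite muln_gt0 f0 expn_gt0 muln_gt0 f0.
case: k => [|k].
  exists 0; first by rewrite mxOver0 ?rpred0.
  by rewrite !mulr0n (_ : ((0 : u0 n.+1)%R * (0 : u0 n.+1)%R)%g = 0 :> u0 n.+1) ?subrr ?mul0rn//; exact: mulg1.
pose F : {poly rat} := f%:R%:P.
have SF : F \in intpoly by rewrite intpolyC rpred_nat.
have iline (z : u0 n.+1) : val z \is a intmx -> 'X *: constmx (val z) \is a mxOver intpoly.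
  move=> /mxOverP h; apply/mxOverP => i j; rewrite !mxE.
  by rewrite rpredM ?intpolyX// intpolyC.
have iexp (A : 'M[{poly rat}]_n.+1) : A \is a mxOver intpoly -> F *: pexp A \is a mxOver intpoly.
  move=> hA; have := @mxOver_series _ _ n A 1 F n.+3 (fun k => (k`!%:R^-1)%:P).
  rewrite expr1n mulr1; apply; rewrite ?rpred1 ?scale1r// => l.
  by rewrite -polyCM intpolyC fact_div_fact_int// -ltnS.
pose W := pexp ('X *: constmx (val x)) * pexp ('X *: constmx (val y)) - 1.
have iW : (F * F) *: W \is a mxOver intpoly.
  rewrite scalerBr rpredB//; last by rewrite scalemx1 mxOver_scalar ?rpred0 ?rpredM.
  have -> : (F * F) *: (pexp ('X *: constmx (val x)) * pexp ('X *: constmx (val y))) =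
     (F *: pexp ('X *: constmx (val x))) * (F *: pexp ('X *: constmx (val y))).
    by rewrite -scalerAl -scalerAr scalerA.
  by apply: mxOverM; apply: iexp; exact: iline.
have iP : E%:R%:P *: bchpath x y \is a mxOver intpoly.
  pose c k : {poly rat} := if k is k'.+1 then ((-1) ^+ k' / k%:R)%:P else 0.
  have -> : bchpath x y = \sum_(k < n.+3) c k *: W ^+ k.
    by rewrite big_ord_recl scale0r add0r.
  have -> : E%:R%:P = F * (F * F) ^+ n.+3 by rewrite /E natrM natrX natrM polyCM rmorphXn/= polyCM.
  apply: mxOver_series => [|l|//]; first by rewrite rpredM.
  rewrite /c; case: (l : nat) (ltn_ord l) => [|m] lm; first by rewrite mulr0 rpred0.
  by rewrite -polyCM intpolyC mulrCA rpredM ?rpredX ?rpredN1// fact_div_int.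
have [gP eP [C eC]] := bchpathP x y.
have iC : E%:R%:P *: C \is a mxOver intpoly.
  apply/mxOverP => i j; have /mxOverP/(_ i j)/intpolyP h : 'X^2 *: (E%:R%:P *: C) \is a mxOver intpoly.
    have -> : 'X^2 *: (E%:R%:P *: C) =
        E%:R%:P *: bchpath x y - E%:R%:P *: ('X *: constmx (val x + val y)).
      by rewrite eC -scalerBr addrAC subrr add0r !scalerA mulrC.
    rewrite rpredB//; apply: mxOverZ; first by rewrite intpolyC rpred_nat.
    apply: (iline (x + y)); apply/mxOverP => a b; rewrite mxE rpredD//.
      by have /mxOverP := ix; apply.
    by have /mxOverP := iy; apply.
  by apply/intpolyP => l; have := h l.+2; rewrite mxE coefXnM /= subn2.
pose w := ((x *+ k.+1)%R * (y *+ k.+1)%R)%g - (x + y) *+ k.+1.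
have ew : val w *+ E = (evalmx k.+1%:R (E%:R%:P *: C)) *+ (k.+1 * k.+1).
  have e1 : evalmx k.+1%:R (bchpath x y) = val ((x + y) *+ k.+1) +
     k.+1%:R ^+ 2 *: evalmx k.+1%:R C.
    rewrite eC rmorphD/= !evalmxZ hornerX hornerXn; congr (_ + _).
    by rewrite evalmx_const val_mulrn raddfD.
  have -> : val w = k.+1%:R ^+ 2 *: evalmx k.+1%:R C.
    by rewrite /w [LHS](raddfB val) -[X in X - _]eP e1 addrC addKr.
  rewrite evalmxZ hornerC.
  by rewrite -!scaler_nat !scalerA natrM -expr2 mulrC.
have [|Z eZ ->] := u0_divn _ ew; first by rewrite muln_gt0.
exists Z => //; rewrite eZ; apply/mxOverP => i j; rewrite mxE; apply: intpoly_horner.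
by have /mxOverP := iC; apply.
Qed.

(** The coordinates of an integral matrix in a basis chosen in [G] have bounded
    denominators, so that the factor and the number of terms are uniform. *)
Lemma qspan_lattice n (G : set (u0 n)) : subgroup G ->
  exists r : nat, exists2 K : nat, (0 < K)%N & forall Z, qspan G Z -> val Z \is a intmx ->
    exists s : seq (u0 n), [/\ size s = r, {in s, forall x, G x} & Z *+ K = \sum_(x <- s) x].
Proof.
move=> sG.
pose sp (X : seq (u0 n)) := <<[seq (val x : 'M[rat]_(n, n)) | x <- X]>>%VS.
have [X XG maxX] : exists2 X : seq (u0 n), {in X, forall x, G x} &
    forall x, G x -> (val x : 'M[rat]_(n, n)) \in sp X.
  pose P k := `[< exists2 X : seq (u0 n), {in X, forall x, G x} & \dim (sp X) = k >].
  have P0 : exists k, P k by exists 0%N; apply/asboolP; exists [::]; rewrite // /sp span_nil dimv0.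
  have Pb k : P k -> (k <= \dim {: 'M[rat]_(n, n)})%N.
    by move=> /asboolP[X _ <-]; apply: dimvS; exact: subvf.
  have [k /asboolP[X XG eX] kmax] := ex_maxnP P0 Pb.
  exists X => // x Gx; apply: contraT => xX.
  have /kmax : P (\dim (sp (x :: X))).
    apply/asboolP; exists (x :: X) => // y; rewrite inE => /orP[/eqP->//|]; exact: XG.
  rewrite leqNgt -eX => /negP[]; rewrite ltnNge; apply: contra xX => le.
  have sub : (sp X <= sp (x :: X))%VS by rewrite /sp /= span_cons addvSr.
  have /eqP -> : sp X == sp (x :: X) by rewrite eqEdim sub.
  by rewrite /sp /= span_cons; apply: subvP (addvSl _ _) _ (memv_line _).
pose t := in_tuple [seq (val x : 'M[rat]_(n, n)) | x <- X].
have [K K0 [a ea]] := common_denominator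
  (fun u : 'I_(size [seq (val x : 'M[rat]_(n, n)) | x <- X]) * ('I_n * 'I_n) =>
     coord t u.1 (delta_mx u.2.1 u.2.2)).
exists (size X); exists K => // Z [m m0 [s hs es]] iZ.
have Zsp : (val Z : 'M[rat]_(n, n)) \in sp X.
  have : (val (Z *+ m) : 'M[rat]_(n, n)) \in sp X.
    by rewrite es raddf_sum/= big_seq; apply: rpred_sum => y /hs/maxX.
  rewrite val_mulrn => /(rpredZ (m%:R^-1)).
  by rewrite scalerA mulVf ?scale1r// pnatr_eq0 -lt0n.
have cK i : K%:R * coord t i (val Z) \is a Num.int.
  rewrite [X in coord _ _ X]matrix_sum_delta linear_sum mulr_sumr; apply: rpred_sum => p _.
  rewrite linear_sum mulr_sumr; apply: rpred_sum => q _.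
  rewrite linearZ/= mulrCA rpredM//; first by have /mxOverP := iZ; apply.
  by have := ea (i, (p, q)) => /= ->; exact: intr_int.
have /fin_all_exists[z hz] : forall i, exists z, K%:R * coord t i (val Z) = z%:~R.
  by move=> i; apply/intrP.
exists [seq X`_(nat_of_ord i) *~ z i
         | i <- enum 'I_(size [seq (val x : 'M[rat]_(n, n)) | x <- X])].
have iX (i : 'I_(size [seq (val x : 'M[rat]_(n, n)) | x <- X])) : (i < size X)%N.
  exact: leq_trans (ltn_ord i) (eq_leq (size_map _ _)).
split.
- exact: etrans (size_map _ _) (etrans (size_enum_ord _) (size_map _ _)).
- by move=> _ /mapP[i _ ->]; apply: subgroup_mulrz => //; apply: XG; exact: mem_nth.
apply: val_inj; rewrite big_map big_enum val_mulrn (raddf_sum val).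
rewrite (coord_span (X := t) Zsp) scaler_sumr; apply: eq_bigr => i _.
by rewrite scalerA hz [RHS]val_mulrz /t /= (nth_map 0)//; exact: iX.
Qed.

(** * The row-major filtration *)

Section Filtration.
Variable n : nat.
Implicit Types (A B W : 'M[rat]_n).

(** The matrices are filtered by the position of the first nonzero entry in
    row-major order. *)
Definition vanishes_before m A := forall i j : 'I_n, (i * n + j < m)%N -> A i j = 0.

Lemma vanishes_beforeD m A B :
  vanishes_before m A -> vanishes_before m B -> vanishes_before m (A + B).
Proof. by move=> hA hB i j ij; rewrite mxE hA ?hB ?addr0. Qed.

Lemma vanishes_before_le m l A : (l <= m)%N ->
  vanishes_before m A -> vanishes_before l A.
Proof. by move=> lm hA i j ij; apply: hA; exact: leq_trans lm. Qed.

(** Right multiplication by a strictly upper triangular matrix moves the first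
    nonzero entry of each row to the right. *)
Lemma vanishes_beforeM m A B : vanishes_before m A -> B \in strict_upper n ->
  vanishes_before m.+1 (A * B).
Proof.
move=> hA /strict_upperP hB i j; rewrite ltnS => ij; rewrite mxE big1// => k _.
case: (leqP j k) => [jk|kj]; first by rewrite hB ?mulr0.
by rewrite hA ?mul0r// (leq_trans _ ij)// ltn_add2l.
Qed.

End Filtration.

Lemma expmx_tail n (A : 'M[rat]_n) : A \in strict_upper n ->
  exists2 B, B \in strict_upper n & expmx A = 1 + (A + A * B).
Proof.
case: n A => [|m] A hA.
  by exists 0; rewrite ?rpred0// [LHS]flatmx0 [RHS]flatmx0.
exists (\sum_(k < m.+1) (k.+2`!%:R^-1 : rat) *: A ^+ k.+1).
  by apply: rpred_sum => k _; apply: strict_upperZ; exact: strict_upperX.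
have -> : expmx A = \sum_(k < m.+3) (k`!%:R^-1 : rat) *: A ^+ k.
  rewrite [in RHS]big_ord_recr [in RHS]big_ord_recr/=.
  by rewrite [A ^+ m.+2]exprS strict_upper_nilp// mulr0 !scaler0 !addr0.
rewrite 2!big_ord_recl mulr_sumr; congr (_ + (_ + _)).
- by rewrite (_ : _^-1 = 1) ?scale1r//; exact: invr1.
- by rewrite (_ : _^-1 = 1) ?scale1r//; exact: invr1.
- by apply: eq_bigr => k _; rewrite -scalerAr -exprS.
Qed.

Lemma logmx_tail n (W : 'M[rat]_n) : W \in strict_upper n ->
  exists2 B, B \in strict_upper n & logmx (1 + W) = W + W * B.
Proof.
case: n W => [|m] W hW.
  by exists 0; rewrite ?rpred0// [LHS]flatmx0 [RHS]flatmx0.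
exists (\sum_(k < m) ((-1) ^+ k.+1 / k.+2%:R : rat) *: W ^+ k.+1).
  by apply: rpred_sum => k _; apply: strict_upperZ; exact: strict_upperX.
rewrite /logmx big_add1 big_mkord [1 + W]addrC addrK.
have -> : \sum_(i < m.+1.-1) ((-1) ^+ i.+2 / i.+1%:R : rat) *: W ^+ i.+1 =
   \sum_(i < m.+1) ((-1) ^+ i / i.+1%:R : rat) *: W ^+ i.+1.
  rewrite [RHS]big_ord_recr/= strict_upper_nilp// scaler0 addr0.
  by apply: eq_bigr => k _; rewrite !exprS mulrA mulrNN mulr1 mul1r.
rewrite big_ord_recl expr0 divr1 scale1r mulr_sumr.
by congr (_ + _); apply: eq_bigr => k _; rewrite -scalerAr -exprS.
Qed.

(** The nonlinear terms of the product have a strictly upper triangular factor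
    on the right, so that the first entry is additive. *)
Lemma vanishes_before_bch n m (x y : u0 n) :
  vanishes_before m (val x) -> vanishes_before m (val y) ->
  vanishes_before m.+1 (val (x * y)%g - (val x + val y)).
Proof.
move=> hx hy; have sx : val x \in strict_upper n := valP x.
have sy : val y \in strict_upper n := valP y.
have [B sB eB] := expmx_tail sx; have [C sC eC] := expmx_tail sy.
pose W := expmx (val x) * expmx (val y) - 1.
have sW : W \in strict_upper n by exact: strict_upper_expM.
have [D sD eD] := logmx_tail sW.
pose p := val x + val x * B; pose q := val y + val y * C.
have hp : vanishes_before m p.
  apply: vanishes_beforeD => //; apply: (@vanishes_before_le _ m.+1) => //.
  exact: vanishes_beforeM.
pose T := val x * B + val y * C + p * q.
have eW : W = val x + val y + T.
  rewrite /W eB eC -/p -/q mulrDl mul1r mulrDr mulr1 -addrA addrC addrA subrK.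
  by rewrite addrAC [RHS]addrA; congr (_ + _); exact: addrACA.
have hT : vanishes_before m.+1 T.
  apply: vanishes_beforeD; first by apply: vanishes_beforeD; exact: vanishes_beforeM.
  by apply: vanishes_beforeM => //; rewrite rpredD// strict_upperM.
have hW : vanishes_before m W.
  rewrite eW; apply: vanishes_beforeD; first exact: vanishes_beforeD.
  exact: vanishes_before_le hT.
have -> : val (x * y)%g = W + W * D by rewrite -eD /W addrC subrK.
rewrite {1}eW -[_ + T + _]addrA addrAC subrr add0r; apply: vanishes_beforeD => //.
exact: vanishes_beforeM.
Qed.

(** The generator is an element with the least positive multiple by [d]. *)
Lemma bounded_subgroup_cyclic (A : rat -> Prop) (d : nat) : (0 < d)%N -> A 0 ->
  (forall a b, A a -> A b -> A (a - b)) -> (forall a, A a -> d%:R * a \is a Num.int) ->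
  exists2 a, A a & forall b, A b -> exists z : int, b = z%:~R * a.
Proof.
move=> d0 A0 AB Ad; have d0' : d%:R != 0 :> rat by rewrite pnatr_eq0 -lt0n.
have AN a : A a -> A (- a) by move=> /(AB 0 a A0); rewrite sub0r.
have Am a (k : nat) : A a -> A (k%:R * a).
  move=> Aa; elim: k => [|k IH]; first by rewrite mul0r.
  by rewrite -natr1 mulrDl mul1r -[a in _ + a]opprK; apply: AB => //; exact: AN.
have Az a (z : int) : A a -> A (z%:~R * a).
  by move=> Aa; case: z => k; [exact: Am|rewrite NegzE mulrNz mulNr; apply/AN/Am].
pose P k := (0 < k)%N && `[< exists2 a, A a & d%:R * a = k%:R >].
have [exP|noP] := pselect (exists k, P k); last first.
  exists 0 => // b Ab; exists 0; rewrite mulr0; apply/eqP; apply: contraT => b0.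
  case: noP; have /intrP[z ez] := Ad _ Ab.
  have z0 : z != 0.
    by apply: contraNneq b0 => z0; move/eqP: ez; rewrite z0 mulf_eq0 (negPf d0').
  exists `|z|%N; rewrite /P absz_gt0 z0 /=; apply/asboolP.
  have [zp|zn] := leP 0 z; first by exists b => //; rewrite ez -{1}(gez0_abs zp).
  by exists (- b); [exact: AN|rewrite mulrN ez -rmorphN/= -ltz0_abs].
have [k Pk kmin] := ex_minnP exP.
have /andP[k0 /asboolP[a Aa ea]] := Pk.
exists a => // b Ab; have /intrP[z ez] := Ad _ Ab.
exists (z %/ k)%Z; pose r := (z %% k)%Z.
have k0z : (k%:Z : int) != 0 by rewrite eqz_nat -lt0n.
have r0 : (0 <= r)%R by exact: modz_ge0.
have rk : (r < k%:Z)%R by apply: ltz_pmod.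
have er : d%:R * (b - (z %/ k)%Z%:~R * a) = r%:~R.
  by rewrite mulrBr ez mulrCA ea {1}(divz_eq z k) rmorphD rmorphM/= addrC addKr.
have r00 : r = 0.
  apply/eqP; apply: contraT => rn0; have := kmin `|r|%N; rewrite /P absz_gt0 rn0 /=.
  have -> : `[< exists2 a0, A a0 & d%:R * a0 = `|r|%N%:R :> rat >].
    apply/asboolP; exists (b - (z %/ k)%Z%:~R * a); first by apply: AB => //; exact: Az.
    by rewrite er -{1}(gez0_abs r0).
  by move=> /(_ isT); rewrite leqNgt -ltz_nat gez0_abs// rk.
move: er; rewrite r00 => /eqP; rewrite mulf_eq0 (negPf d0') subr_eq0.
by move=> /eqP.
Qed.

(** * Cyclic layers *)

Local Open Scope classical_set_scope.

Definition bounded_denom n (d : nat) (G : set (u0 n)) :=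
  forall x, G x -> val (x *+ d) \is a intmx.

Lemma generated_subgroup (gT : groupType) (S : set gT) : subgroup (generated S).
Proof.
split=> [A [[]]//|x y hx hy A hA|x hx A hA].
  by case: (hA) => -[_ AM _] _; apply: AM; [exact: hx|exact: hy].
by case: (hA) => -[_ _ AV] _; apply: AV; exact: hx.
Qed.

(** Coverings by cosets with arbitrary representatives compose and restrict,
    which gives bounds on indices without any choice of transversals. *)
Definition covered (gT : groupType) (G N : set gT) (c : nat) :=
  exists2 T : seq gT, (size T <= c)%N &
    forall x, G x -> exists2 t, t \in T & N (t^-1 * x)%g.

Section Layers.
Variables (n d : nat) (G : set (u0 n)).
Hypothesis d0 : (0 < d)%N.
Hypothesis sG : subgroup G.
Hypothesis bG : bounded_denom d G.

Lemma vanishes_bchE m (x y : u0 n) (i j : 'I_n) :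
  vanishes_before m (val x) -> vanishes_before m (val y) -> (i * n + j < m.+1)%N ->
  val (x * y)%g i j = val x i j + val y i j.
Proof.
move=> hx hy ij; apply/eqP; rewrite -subr_eq0; apply/eqP.
by have := vanishes_before_bch hx hy ij; rewrite !mxE.
Qed.

Lemma vanishes_before_mulg m (x y : u0 n) :
  vanishes_before m (val x) -> vanishes_before m (val y) ->
  vanishes_before m (val (x * y)%g).
Proof.
by move=> hx hy i j ij; rewrite (vanishes_bchE hx hy) ?hx ?hy ?addr0// ltnS ltnW.
Qed.

Lemma vanishes_before_mulrz m (x : u0 n) (z : int) :
  vanishes_before m (val x) -> vanishes_before m (val (x *~ z)).
Proof. by move=> hx i j ij; rewrite val_mulrz mxE hx ?mulr0. Qed.

Lemma vanishes_before_all (x : u0 n) : vanishes_before (n * n) (val x) -> x = 0.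
Proof.
move=> hx; apply: val_inj; apply/matrixP => i j; rewrite hx ?mxE//.
have : (i * n + n <= n * n)%N by rewrite addnC -mulSn leq_mul2r ltn_ord orbT.
by apply: leq_trans; rewrite ltn_add2l.
Qed.

(** The entry at position [m] is an additive map on the layer, with values in a
    cyclic group.  Powers of the generator [a] can be split between the two
    sides, since left and right multiplication change that entry alike. *)
Lemma cyclic_layer m : (m < n * n)%N ->
  exists a, [/\ G a, vanishes_before m (val a) &
    forall x, G x -> vanishes_before m (val x) -> exists z : int,
      forall z1 z2 : int, z1 + z2 = z ->
        vanishes_before m.+1 (val ((a *~ z1)%R^-1 * x * (a *~ z2)%R^-1)%g)].
Proof.
move=> mn; have n0 : (0 < n)%N by case: (n) mn => //; rewrite muln0.
have im : (m %/ n < n)%N by rewrite ltn_divLR.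
have jm : (m %% n < n)%N by rewrite ltn_mod.
pose i := Ordinal im; pose j := Ordinal jm.
have eij : (i * n + j)%N = m by rewrite /= -divn_eq.
have uij (k l : 'I_n) : (k * n + l)%N = m -> k = i /\ l = j.
  move=> e; split; apply: val_inj => /=; rewrite -e.
    by rewrite divnMDl// divn_small ?addn0.
  by rewrite modnMDl modn_small.
pose A q := exists x, [/\ G x, vanishes_before m (val x) & val x i j = q].
have [||//|q [a [Ga ha ea]] hq] := @bounded_subgroup_cyclic A d d0.
- by exists 0; case: sG => G1 _ _; split => //; [move=> k l _; rewrite mxE|rewrite mxE].
- move=> _ _ [x [Gx hx <-]] [y [Gy hy <-]]; exists (x * y^-1)%g.
  have hy' : vanishes_before m (val (y^-1)%g).
    by move=> k l kl; have := vanishes_before_mulrz (-1) hy kl; rewrite mulrNz.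
  case: (sG) => _ GM GV; split; first by apply: GM => //; exact: GV.
    exact: vanishes_before_mulg.
  rewrite (vanishes_bchE hx hy') ?eij//; congr (_ + _).
  by rewrite [val _](raddfN val y) mxE.
- move=> _ [x [Gx _ <-]]; have /mxOverP/(_ i j) := bG Gx.
  by rewrite val_mulrn mxE.
exists a; split => // x Gx hx.
have [|z ez] := hq (val x i j); first by exists x.
exists z => z1 z2 ezz.
have N w : (a *~ w)%R^-1%g = a *~ (- w) by rewrite mulrNz.
rewrite !N; have h w := vanishes_before_mulrz (- w) ha.
have h1 := vanishes_before_mulg (h z1) hx.
move=> k l; rewrite ltnS leq_eqVlt => /orP[/eqP/uij[-> ->]|kl]; last first.
  exact: (vanishes_before_mulg h1 (h z2)).
rewrite (vanishes_bchE h1 (h z2)) ?eij// (vanishes_bchE (h z1) hx) ?eij//.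
rewrite !val_mulrz !mxE ez ea -ezz !rmorphN/= rmorphD/=; ring.
Qed.

(** In each layer the exponent of the generator matters modulo [K] only. *)
Lemma covered_powers (N : set (u0 n)) (K : nat) : (0 < K)%N -> subgroup N ->
  (forall x, G x -> N (x *+ K)) -> covered G N (K ^ (n * n)).
Proof.
move=> K0 sN hK; have [N1 NM NV] := sN; have [G1 GM GV] := sG.
suff cov r m : (m + r)%N = (n * n)%N ->
    covered (G `&` [set x | vanishes_before m (val x)]) N (K ^ r).
  have [T sT hT] := cov (n * n)%N 0%N erefl; exists T => // x Gx.
  by apply: hT; split.
elim: r m => [|r IH] m.
  rewrite addn0 => ->; exists [:: 0] => // x [Gx hx].
  exists 0; first by rewrite mem_head.
  by rewrite (vanishes_before_all hx) mulVg.
rewrite addnS -addSn => mr; have [T sT hT] := IH _ mr.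
have mn : (m < n * n)%N by rewrite -mr leq_addr.
have [a [Ga ha hlayer]] := cyclic_layer mn.
exists [seq (((a *+ k)%R : u0 n) * t)%g | k <- iota 0 K, t <- T].
  by rewrite size_allpairs size_iota expnS leq_mul2l sT orbT.
move=> x [Gx hx]; have [z hz] := hlayer x Gx hx.
pose r0 := `|(z %% K)%Z|%N; pose q := (z %/ K)%Z.
have K0z : K%:Z != 0 by rewrite eqz_nat -lt0n.
have er0 : (r0%:Z = (z %% K)%Z) by rewrite /r0 gez0_abs// modz_ge0.
have ez : r0%:Z + q * K%:Z = z by rewrite er0 addrC -divz_eq.
(* The power of [a] with exponent divisible by [K] is put on the right, where
   it is absorbed by [N]. *)
pose y := ((a *~ r0%:Z)%R^-1 * x * (a *~ (q * K%:Z))%R^-1)%g.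
have Gy : G y.
  by apply: (GM); [apply: GM => //; apply: GV|apply: GV]; exact: subgroup_mulrz.
have [|t tT Nt] := hT y; first by split => //; exact: hz.
exists (((a *+ r0)%R : u0 n) * t)%g.
  apply/allpairsP; exists (r0, t); split => //=.
  by rewrite mem_iota /= add0n -ltz_nat er0 ltz_pmod.
have -> : (((a *+ r0)%R * t)^-1 * x = t^-1 * y * (a *~ (q * K%:Z))%R)%g.
  by rewrite /y -!mulgA mulVg mulg1 invgM mulgA.
apply: NM => //; rewrite mulrC mulrzA; apply: subgroup_mulrz => //.
exact: hK.
Qed.

(** Generators of the cyclic layers generate the group. *)
Lemma bounded_finitely_generated : finitely_generated G.
Proof.
have [G1 GM GV] := sG.
have sgen := @generated_subgroup (u0 n).
suff gen r m : (m + r)%N = (n * n)%N -> exists2 s : seq (u0 n), {in s, forall x, G x} &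
    forall x, G x -> vanishes_before m (val x) -> generated [set` s] x.
  have [s sG' hs] := gen (n * n)%N 0%N erefl; exists [set` s]; split.
    exact: finite_seq.
  apply/seteqP; split; first by apply: smallest_sub.
  by move=> x Gx; exact: hs.
elim: r m => [|r IH] m.
  rewrite addn0 => ->; exists [::] => // x Gx /vanishes_before_all ->.
  by have [e _ _] := sgen [set` [::]]; exact: e.
rewrite addnS -addSn => mr; have [s sG' hs] := IH _ mr.
have mn : (m < n * n)%N by rewrite -mr leq_addr.
have [a [Ga ha hlayer]] := cyclic_layer mn.
exists (a :: s) => [x|x Gx hx]; first by rewrite inE => /orP[/eqP ->|/sG'].
have [z hz] := hlayer x Gx hx.
have ga : generated [set` a :: s] (a *~ z).
  apply: (@subgroup_mulrz _ (generated [set` a :: s])); first exact: sgen.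
  by apply: (@sub_gen_smallest _ _ [set` a :: s]); exact: mem_head.
have := hz z 0 (addr0 z); rewrite mulr0z; set y := (_ * _ * _)%g => hy.
have -> : x = ((a *~ z)%R * y)%g.
  have e0 : (0 : u0 n)^-1%g = 1%g by exact: oppr0.
  by rewrite /y e0 mulg1 mulVKg.
have [_ SM _] := sgen [set` a :: s]; apply: SM => //.
have ys : generated [set` s] y.
  apply: hs => //; apply: (GM); last by apply: GV.
  by apply: (GM) => //; apply: GV; exact: subgroup_mulrz.
apply: (smallest_sub (sgen [set` a :: s]) _ ys) => u /= us.
by apply: (@sub_gen_smallest _ _ [set` a :: s]); rewrite /= inE us orbT.
Qed.

End Layers.

(** * Words and coset coverings *)

Section Words.
Variable gT : groupType.
Implicit Types (S G N : set gT) (g x y : gT).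
Local Notation expr := expressible_by_word.

Lemma word1 S : expr S 1%g 0.
Proof. by exists [::]; split => //; rewrite big_nil. Qed.

Lemma word0_eq1 S x : expr S x 0 -> x = 1%g.
Proof. by case=> s [/size0nil -> _ <-]; rewrite big_nil. Qed.

Lemma word_cons S x y k : S x \/ S x^-1%g -> expr S y k -> expr S (x * y)%g k.+1.
Proof.
move=> Sx [s [<- hs <-]]; exists (x :: s); split => //; last by rewrite big_cons.
by move=> z; rewrite inE => /orP[/eqP ->//|/hs].
Qed.

Lemma word_consP S x k : expr S x k.+1 ->
  exists y z, [/\ S y \/ S y^-1%g, expr S z k & x = (y * z)%g].
Proof.
case=> -[|y s] [] // [sk] hs <-; exists y, (\prod_(z <- s) z)%g; split.
- by apply: hs; rewrite mem_head.
- by exists s; split => // z zs; apply: hs; rewrite inE zs orbT.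
- by rewrite big_cons.
Qed.

Lemma wordM S x y k l : expr S x k -> expr S y l -> expr S (x * y)%g (k + l).
Proof.
elim: k x => [|k IH] x; first by move=> /word0_eq1 ->; rewrite mul1g.
move=> /word_consP[u [v [Su hv ->]]] hy; rewrite -mulgA addSn.
by apply: word_cons => //; exact: IH.
Qed.

Lemma word_gen S x : S x \/ S x^-1%g -> expr S x 1.
Proof. by move=> Sx; rewrite -[x]mulg1; apply: word_cons => //; exact: word1. Qed.

Lemma wordV S x k : expr S x k -> expr S x^-1%g k.
Proof.
elim: k x => [|k IH] x; first by move=> /word0_eq1 ->; rewrite invg1; exact: word1.
move=> /word_consP[u [v [Su hv ->]]]; rewrite invgM -addn1; apply: wordM; first exact: IH.
by apply: word_gen; rewrite invgK; case: Su; [right|left].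
Qed.

Lemma wordX S x k m : expr S x k -> expr S (x ^+ m)%g (m * k).
Proof.
move=> hx; elim: m => [|m IH]; first exact: word1.
by rewrite expgS mulSn; apply: wordM.
Qed.

Lemma sub_generated S : S `<=` generated S.
Proof. exact: sub_gen_smallest. Qed.

Lemma generated_word S x : generated S x -> exists k, expr S x k.
Proof.
move=> /(_ [set x | exists k, expr S x k]); apply; split; last first.
  by move=> y Sy; exists 1%N; apply: word_gen; left.
split; first by exists 0%N; exact: word1.
- by move=> y z [k hk] [l hl]; exists (k + l)%N; exact: wordM.
- by move=> y [k hk]; exists k; exact: wordV.
Qed.

Lemma word_generated S x k : expr S x k -> generated S x.
Proof.
have [G1 GM GV] := generated_subgroup S.
elim: k x => [|k IH] x; first by move=> /word0_eq1 ->.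
move=> /word_consP[u [v [Su hv ->]]]; apply: GM; last exact: IH.
by case: Su => [/sub_generated//|/sub_generated/GV]; rewrite invgK.
Qed.

Lemma word_bounded S (s : seq gT) : exists L, forall x, x \in s -> generated S x ->
  exists2 k, (k <= L)%N & expr S x k.
Proof.
elim: s => [|y s [L hL]]; first by exists 0%N.
have [/generated_word[l hl]|ny] := pselect (generated S y); last first.
  by exists L => x; rewrite inE => /orP[/eqP -> //|]; exact: hL.
exists (maxn l L) => x; rewrite inE => /orP[/eqP -> _|xs gx].
  by exists l => //; exact: leq_maxl.
have [k kL hk] := hL x xs gx; exists k => //.
by rewrite (leq_trans kL)// leq_maxr.
Qed.

(** Replace each letter by a word in the other generators. *)
Lemma word_change S S' (s : seq gT) : S = [set` s] -> S `<=` generated S' ->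
  exists L, forall x k, expr S x k -> exists2 l, (l <= L * k)%N & expr S' x l.
Proof.
move=> eS SS'; have [L hL] := word_bounded S' (s ++ [seq x^-1%g | x <- s]).
have [_ _ GV] := generated_subgroup S'.
exists L => x k; elim: k x => [|k IH] x.
  by move=> /word0_eq1 ->; exists 0%N; rewrite ?muln0//; exact: word1.
move=> /word_consP[u [v [Su /IH[l lk hl] ->]]].
have [||m mL hm] := hL u.
- rewrite mem_cat; case: Su; rewrite eS /= => us; first by rewrite us.
  by apply/orP; right; apply/mapP; exists (u^-1)%g; rewrite ?invgK.
- by case: Su => /SS'// /GV; rewrite invgK.
exists (m + l)%N; first by rewrite mulnS leq_add.
exact: wordM.
Qed.

End Words.

Section Covering.
Variable gT : groupType.
Implicit Types (G M N : set gT).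

Lemma covered_trans G M N a b : covered G M a -> covered M N b -> covered G N (a * b).
Proof.
move=> [T sT hT] [U sU hU]; exists [seq (t * u)%g | t <- T, u <- U].
  by rewrite size_allpairs leq_mul.
move=> x /hT[t tT /hU[u uU h]]; exists (t * u)%g; first exact: allpairs_f.
by rewrite invgM -mulgA.
Qed.

Lemma covered_le G N a b : (a <= b)%N -> covered G N a -> covered G N b.
Proof. by move=> ab [T sT hT]; exists T => //; exact: leq_trans ab. Qed.

Lemma covered_sub G M N c : subgroup N -> subgroup M -> M `<=` G ->
  covered G N c -> covered M (N `&` M) c.
Proof.
move=> [N1 NM NV] [M1 MM MV] MG [T sT hT].
(* For each coset that meets M, a representative in M. *)
have ch (t : gT) : exists u, (exists2 x, M x & N (t^-1 * x)%g) -> M u /\ N (t^-1 * u)%g.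
  have [[x Mx Nx]|h] := pselect (exists2 x, M x & N (t^-1 * x)%g); last by exists 1%g.
  by exists x.
have [f hf] := choice ch; exists [seq f t | t <- T]; first by rewrite size_map.
move=> x Mx; have [t tT Nt] := hT x (MG _ Mx).
have [|Mf Nf] := hf t; first by exists x.
exists (f t); first exact: map_f.
split; last by apply: MM => //; exact: MV.
by have := NM _ _ (NV _ Nf) Nt; rewrite invgM invgK -mulgA mulVKg.
Qed.

(** Schreier rewriting: coset representatives inserted between consecutive
    letters turn a word into a product of elements of a finite subset of the
    smaller group, one for each letter and two for the ends. *)
Lemma finite_index_undistorted (S1 S2 : set gT) (s1 : seq gT) c :
  S1 = [set` s1] -> generated S2 `<=` generated S1 ->
  covered (generated S1) (generated S2) c ->
  exists L, forall x k, generated S2 x -> (0 < k)%N -> expressible_by_word S1 x k ->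
    exists2 l, (l <= L * k)%N & expressible_by_word S2 x l.
Proof.
move=> eS1 M12 [T _ hT]; have [M1 MM MV] := generated_subgroup S2.
have [G1 GM GV] := generated_subgroup S1.
pose sg := s1 ++ [seq x^-1%g | x <- s1].
have hsg u : S1 u \/ S1 u^-1%g -> u \in sg.
  rewrite /sg mem_cat eS1 => -[/= ->//|us]; apply/orP; right.
  by apply/mapP; exists (u^-1)%g; rewrite ?invgK.
pose E := T ++ [seq t^-1%g | t <- T] ++
  [seq (w * t)%g | w <- [seq (t^-1 * u)%g | t <- T, u <- sg], t <- T].
have [L hL] := word_bounded S2 E.
have step x k : expressible_by_word S1 x k -> exists t, [/\ t \in T, generated S2 (t^-1 * x)%g
    & exists2 l, (l <= L * k.+1)%N & expressible_by_word S2 (t^-1 * x)%g l].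
  elim: k x => [|k IH] x.
    move=> /word0_eq1 ->; have [t tT ht] := hT 1%g G1; exists t; split => //.
    rewrite mulg1 in ht *; have [||l lL hl] := hL t^-1%g => //.
      by rewrite /E !mem_cat map_f ?orbT.
    by exists l => //; rewrite muln1.
  move=> hx; have Gx := word_generated hx; have [t' t'T ht'] := hT x Gx.
  move: hx => /word_consP[u [v [Su /IH[t [tT ht [l lk hl]]] ex]]].
  have e : (t'^-1 * x = (t'^-1 * u * t) * (t^-1 * v))%g by rewrite ex -!mulgA mulVKg.
  exists t'; split => //; rewrite e.
  have [||m mL hm] := hL (t'^-1 * u * t)%g.
  - rewrite /E !mem_cat; apply/orP; right; apply/orP; right.
    by apply: allpairs_f => //; apply: allpairs_f => //; exact: hsg.
  - have -> : (t'^-1 * u * t = (t'^-1 * x) * (t^-1 * v)^-1)%g.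
      by rewrite e mulgK.
    by apply: MM => //; exact: MV.
  exists (m + l)%N; last exact: wordM.
  by rewrite mulnS leq_add.
exists (L * 3)%N => x k Mx k0 /step[t [tT ht [l lk hl]]].
have [||m mL hm] := hL t.
- by rewrite /E mem_cat tT.
- by have := MM _ _ Mx (MV _ ht); rewrite invgM invgK mulVKg.
exists (m + l)%N; last by rewrite -[x](mulVKg t); exact: wordM.
apply: (@leq_trans (L + L * k.+1)); first by rewrite leq_add.
by rewrite -mulnS -mulnA leq_mul2l; move: k0; case: (k) => // k' _; apply/orP; right; lia.
Qed.

End Covering.

(** * Index and residual finiteness growth *)

Section Index.
Variables (R : realType) (gT : groupType).
Implicit Types (S G N : set gT) (g x y : gT) (P : set (set gT)).
Local Notation expr := expressible_by_word.

Lemma word_norm_leP S g (r : R) : (word_norm R S g <= r%:E)%E ->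
  exists2 k, expr S g k & k%:R <= r.
Proof.
move=> h; have [[k hk]|no] := pselect (exists k, expr S g k); last first.
  move: h; rewrite /word_norm (_ : [set _ | _ in _] = set0) ?ereal_inf0//.
  by apply/seteqP; split => // t [k hk _]; case: no; exists k.
have exb : exists k, `[< expr S g k >] by exists k; apply/asboolP.
have [m /asboolP hm mmin] := ex_minnP exb; exists m => //.
rewrite -lee_fin; apply: le_trans h; apply: le_ereal_inf_tmp => _ [l hl <-].
by rewrite lee_fin ler_nat; apply: mmin; apply/asboolP.
Qed.

Lemma word_norm_le S g k : expr S g k -> (word_norm R S g <= k%:R%:E)%E.
Proof. by move=> h; apply: ereal_inf_lbound; exists k. Qed.

Lemma word_norm_gt0 S g : g <> 1%g -> (0 < word_norm R S g)%E.
Proof.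
move=> g1; apply: (@lt_le_trans _ _ 1%E); first by rewrite lte_fin.
apply: le_ereal_inf_tmp => _ [[|k] hk <-]; first by case: g1; exact: word0_eq1 hk.
by rewrite lee_fin ler1n.
Qed.

Lemma word_norm_gt0_neq1 S g : (0 < word_norm R S g)%E -> g <> 1%g.
Proof. by move=> h e; have := word_norm_le (word1 S); rewrite -e leNgt h. Qed.

Lemma subgroup_index_le G N c : subgroup N -> covered G N c ->
  (subgroup_index R G N <= c%:R%:E)%E.
Proof.
move=> [N1 NM NV] [T sT hT].
pose cs t := [set (t * y)%g | y in N].
have sub : left_cosets G N `<=` [set` [seq cs t | t <- T]].
  move=> _ [x Gx <-]; have [t tT Nt] := hT x Gx.
  apply/mapP; exists t => //; apply/seteqP; split => _ [y Ny <-].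
    exists (t^-1 * x * y)%g; first exact: NM.
    by rewrite -!mulgA mulVKg.
  exists ((t^-1 * x)^-1 * y)%g; first by apply: NM => //; exact: NV.
  by rewrite invgM invgK !mulgA mulgV mul1g.
have fin : finite_set (left_cosets G N).
  by apply: sub_finite_set sub _; exact: finite_seq.
rewrite /subgroup_index; case: asboolP => // _; rewrite lee_fin ler_nat.
apply: leq_trans sT; rewrite -(size_map cs).
apply: uniq_leq_size; first exact: fset_uniq.
move=> A; rewrite in_fset_set// inE => /sub; by [].
Qed.

Lemma covered_index G N : subgroup N -> subgroup_index R G N = +oo%E \/
  exists2 c, subgroup_index R G N = c%:R%:E & covered G N c.
Proof.
move=> [N1 _ NV]; rewrite /subgroup_index; case: asboolP => [fin|_]; [right|by left].
exists #|` fset_set (left_cosets G N)| => //.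
exists [seq xget 1%g A | A <- fset_set (left_cosets G N)]; first by rewrite size_map.
move=> x Gx; pose A := [set (x * y)%g | y in N].
exists (xget 1%g A).
  by apply: map_f; rewrite in_fset_set// inE; exists x.
have [y Ny <-] : A (xget 1%g A) by apply: xgetPex; exists (x * 1)%g; exists 1%g.
by rewrite invgM -mulgA mulVg mulg1; exact: NV.
Qed.

Lemma subgroup_index_ge1 G N : G 1%g -> (1 <= subgroup_index R G N)%E.
Proof.
move=> G1; rewrite /subgroup_index; case: asboolP => [fin|_]; last by rewrite leey.
rewrite lee_fin ler1n cardfs_gt0; apply/fset0Pn.
exists [set (1 * y)%g | y in N]; rewrite in_fset_set// inE; by exists 1%g.
Qed.

Lemma separation_index_ge1 G P g : G 1%g -> (1 <= separation_index R G P g)%E.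
Proof.
by move=> G1; apply: le_ereal_inf_tmp => _ [N _ <-]; exact: subgroup_index_ge1.
Qed.

Lemma RF_ge1 G P S r : G 1%g -> (1 <= RF G P S r :> \bar R)%E.
Proof.
move=> G1; rewrite /RF; case: ifPn => // /set0P[t [g hg _]].
by apply: le_ereal_sup_tmp; exists (separation_index R G P g);
  [exists g|exact: separation_index_ge1].
Qed.

End Index.

Lemma separation_index_le (R : realType) (gT gT' : groupType) (G : set gT) P g
    (G' : set gT') P' g' (C : nat) : (0 < C)%N ->
  (forall N', P' N' -> ~ N' g' -> exists N, [/\ P N, ~ N g &
     (subgroup_index R G N <= C%:R%:E * subgroup_index R G' N')%E]) ->
  (separation_index R G P g <= C%:R%:E * separation_index R G' P' g')%E.
Proof.
move=> C0 h; have C0' : (0 < C%:R :> R) by rewrite ltr0n.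
rewrite -lee_pdivrMl//; apply: le_ereal_inf_tmp => _ [N' [PN' N'g] <-].
rewrite lee_pdivrMl//; have [N [PN Ng le]] := h _ PN' N'g.
apply: le_trans le; apply: ereal_inf_lbound; exists N => //; by split.
Qed.

(** One linear bound [C] serves for the word length and for the separation index.
    The values of [RF] are at least 1, which covers the conventional value 1. *)
Lemma growth_le_RF (R : realType) (gT : groupType) (G G' S S' : set gT) P P' (C : nat) :
  (0 < C)%N -> G' 1%g ->
  (forall g k, G g -> g <> 1%g -> (0 < k)%N -> expressible_by_word S g k ->
    exists g', [/\ G' g', g' <> 1%g,
      (exists2 l, (l <= C * k)%N & expressible_by_word S' g' l) &
      (separation_index R G P g <= C%:R%:E * separation_index R G' P' g')%E]) ->
  growth_le (RF (R := R) G P S) (RF (R := R) G' P' S').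
Proof.
move=> C0 G1 h; have C0' : (0 < C%:R :> R) by rewrite ltr0n.
exists C%:R => // r _; set rhs := (_ * _)%E.
have rhs1 : (C%:R%:E <= rhs)%E.
  rewrite -[X in (X <= _)%E]mule1; apply: lee_wpmul2l; first by rewrite lee_fin ltW.
  exact: RF_ge1.
rewrite /RF; case: ifPn => _.
  by apply: le_trans rhs1; rewrite lee_fin ler1n.
apply: ge_ereal_sup => _ [g [Gg /andP[/word_norm_gt0_neq1 g1 /word_norm_leP[k hk kr]]] <-].
have k0 : (0 < k)%N by case: k hk {kr} => // /word0_eq1.
have [g' [Gg' g'1 [l lk hl] le]] := h g k Gg g1 k0 hk.
apply: le_trans le _; apply: lee_wpmul2l; first by rewrite lee_fin ltW.
have D' : [set g0 | G' g0 /\ (0 < word_norm R S' g0 <= (C%:R * r)%:E)%E] g'.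
  split => //; apply/andP; split; first exact: word_norm_gt0.
  apply: le_trans (word_norm_le R hl) _; rewrite lee_fin.
  apply: (@le_trans _ _ (C * k)%:R); first by rewrite ler_nat.
  by rewrite natrM ler_pM2l.
rewrite /RF; case: ifPn => [/eqP e|_].
  have : set0 (separation_index R G' P' g') by rewrite -e; exists g'.
  by [].
by apply: ereal_sup_ubound; exists g'.
Qed.

(** * Invariant normal subgroups *)

Section Automorphisms.
Variables (gT : groupType) (G : set gT) (H : set (gT -> gT)).
Hypothesis HG : subgroup_of_Aut G H.

Lemma subgroup_of_Aut_inverse f : H f ->
  exists f', [/\ H f', cancel f f' & cancel f' f].
Proof.
have [_ _ _ HV] := HG => Hf; have [f' Hf' fK] := HV f Hf.
have [f'' Hf'' f'K] := HV f' Hf'; exists f'; split => // x.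
have e z : f z = f'' z by rewrite -[LHS]f'K fK.
by rewrite e f'K.
Qed.

(** Stability suffices for invariance, since [H] is closed under inverses. *)
Lemma H_invariantP (N : set gT) :
  (forall f x, H f -> N x -> N (f x)) -> H_invariant H N.
Proof.
move=> h f Hf; have [f' [Hf' fK f'K]] := subgroup_of_Aut_inverse Hf.
apply/seteqP; split => [_ [x Nx <-]|x Nx]; first exact: h.
by exists (f' x); [exact: h|exact: f'K].
Qed.

Lemma H_invariant_sub (N : set gT) f x : H_invariant H N -> H f -> N x -> N (f x).
Proof. by move=> hN Hf Nx; rewrite -(hN f Hf); exists x. Qed.

Lemma Aut_mem f x : H f -> G x -> G (f x).
Proof.
have [HA _ _ _] := HG; move=> /HA[[fG _ _] _ _]; exact: fG.
Qed.

Lemma Aut_mul f x y : H f -> G x -> G y -> f (x * y)%g = (f x * f y)%g.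
Proof. by have [HA _ _ _] := HG; move=> /HA[_ + _]; apply. Qed.

Definition normal_core (N : set gT) : set gT := [set x | forall g, G g -> N (x ^ g)%g].

Hypothesis sG : subgroup G.

Lemma normal_core_sub N : normal_core N `<=` N.
Proof. by have [G1 _ _] := sG; move=> x /(_ 1%g G1); rewrite conjg1. Qed.

Lemma normal_core_subgroup N : subgroup N -> subgroup (normal_core N).
Proof.
move=> [N1 NM NV]; split=> [g Gg|x y hx hy g Gg|x hx g Gg]; first by rewrite conj1g.
  by rewrite conjMg; apply: NM; [exact: hx|exact: hy].
by rewrite conjVg; apply: NV; exact: hx.
Qed.

(** The automorphisms permute the conjugates of an invariant subgroup. *)
Lemma normal_core_invariant (N : set gT) : subgroup N -> N `<=` G -> H_invariant H N ->
  invariant_normal_subgroups H G (normal_core N).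
Proof.
move=> sN NG hN; have [G1 GM GV] := sG; split.
  split; first exact: normal_core_subgroup.
    by move=> x /normal_core_sub/NG.
  by move=> x g hx Gg k Gk; rewrite -conjgM; apply: hx; exact: GM.
apply: H_invariantP => f x Hf hx g Gg.
have [f' [Hf' fK f'K]] := subgroup_of_Aut_inverse Hf.
have Gx : G x by exact: (NG _ (normal_core_sub hx)).
have Gg' : G (f' g) by exact: Aut_mem.
have homf : forall u v, G u -> G v -> f (u * v)%g = (f u * f v)%g.
  by move=> u v Gu Gv; exact: Aut_mul.
have e : (f x ^ g = f (x ^ f' g))%g.
  have Gi : G (f' g)^-1%g by exact: GV.
  have Gxg : G (x * f' g)%g by exact: GM.
  by rewrite !conjgE homf// homf// (homV sG homf)// f'K.
rewrite e; exact: (H_invariant_sub hN Hf (hx _ Gg')).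
Qed.

Lemma invariant_normal_subgroupI (N M : set gT) : subgroup M -> M `<=` G ->
  H_invariant H M -> invariant_normal_subgroups H G N ->
  invariant_normal_subgroups H M (N `&` M).
Proof.
move=> [M1 MM MV] MG hM [[[N1 NM NV] NG Nn] hN]; split; last first.
  apply: H_invariantP => f x Hf [Nx Mx].
  by split; [exact: (H_invariant_sub hN Hf)|exact: (H_invariant_sub hM Hf)].
split.
- split => //; first by move=> x y [Nx Mx] [Ny My]; split; [exact: NM|exact: MM].
  by move=> x [Nx Mx]; split; [exact: NV|exact: MV].
- by move=> x [].
- move=> x g [Nx Mx] Mg; split; first by apply: Nn => //; exact: MG.
  by rewrite conjgE; apply: (MM); [exact: MV|exact: MM].
Qed.

End Automorphisms.

(** * The invariant LR-subgroup *)

Lemma bracket_mulrn n (x y : u0 n) k :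
  bracket (x *+ k) (y *+ k) = bracket x y *+ (k * k).
Proof.
apply: val_inj; rewrite val_mulrn natrM.
rewrite -[val (bracket (x *+ k) _)]/(val (x *+ k) *m val (y *+ k) - val (y *+ k) *m val (x *+ k)).
rewrite !val_mulrn -!scalemxAl -!scalemxAr !scalerA -scalerBr //.
Qed.

Section Construction.
Variables (n : nat) (G1 : set (u0 n)) (H : set (u0 n -> u0 n)).
Hypothesis sG : subgroup G1.
Hypothesis HG : subgroup_of_Aut G1 H.

Definition scaled_span (K : nat) : set (u0 n) := [set v *+ K | v in zspan G1].

Lemma scaled_spanD K x y :
  scaled_span K x -> scaled_span K y -> scaled_span K (x + y).
Proof.
by move=> [v hv <-] [w hw <-]; exists (v + w); [exact: zspanD|rewrite mulrnDl].
Qed.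

Lemma scaled_span0 K : scaled_span K 0.
Proof. by exists 0; [exact: zspan0|rewrite mul0rn]. Qed.

Lemma scaled_spanN K x : scaled_span K x -> scaled_span K (- x).
Proof. by move=> [v hv <-]; exists (- v); [exact: zspanN|rewrite mulNrn]. Qed.

Lemma scaled_span_mulrn K x k : scaled_span K x -> scaled_span K (x *+ k).
Proof.
by move=> [v hv <-]; exists (v *+ k); [exact: zspan_mulrn|rewrite mulrnAC].
Qed.

Lemma scaled_span_pow K x : G1 x -> scaled_span K (x *+ K).
Proof. by move=> Gx; exists x => //; exact: zspan_sub. Qed.

(** The automorphisms are linear on the span, as far as they are defined. *)
Lemma scaled_span_invariant K : scaled_span K `<=` G1 -> H_invariant H (scaled_span K).
Proof.
move=> KG; apply: (H_invariantP HG) => f _ Hf [_ [s hs ->] <-].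
have fM := fun x y => @Aut_mul _ _ _ HG f x y Hf.
have Gf x : G1 x -> G1 (f x) by exact: (Aut_mem HG Hf).
exists (\sum_(x <- s) f x).
  exists [seq f x | x <- s]; last by rewrite big_map.
  by move=> _ /mapP[x /hs/Gf Gx ->].
have k0 : (0 < sumcoef n ^ size s)%N by rewrite expn_gt0 sumcoef_gt0.
apply: (mulrn_inj k0); set v := \sum_(x <- s) x.
have GvK : G1 (v *+ K) by apply: KG; exists v => //; exists s.
have Gv := subgroup_mulr_sum sG hs; rewrite -/v in Gv.
rewrite -(hom_mulrn _ sG fM GvK) [v *+ K *+ _]mulrnAC (hom_mulrn _ sG fM Gv).
by rewrite (hom_sum_multiple sG fM hs) mulrnAC.
Qed.

Hypothesis fG : finitely_generated G1.

(** The terms of higher order in the product, like the bracket, carry a second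
    factor [K], which absorbs the bounded denominators. *)
Lemma exists_LR_multiple : exists2 K, (0 < K)%N &
  scaled_span K `<=` G1 /\ LR_group (scaled_span K).
Proof.
have [d d0 hd] := bounded_denominators fG.
have [r [K1 K10 hK1]] := qspan_lattice sG.
have [E E0 hE] := bch_second_order n.
(* [d] clears the denominators in the span, [K1 * M] moves the integral points
   of the rational span into [G1], and [E] those of the higher order terms. *)
pose M := (sumcoef n ^ r)%N; pose L := (d * (K1 * M))%N; pose K' := (E * L)%N.
have M0 : (0 < M)%N by rewrite expn_gt0 sumcoef_gt0.
have L0 : (0 < L)%N by rewrite !muln_gt0 d0 K10.
have K'0 : (0 < K')%N by rewrite muln_gt0 E0.
pose K := (d * K')%N; have K0 : (0 < K)%N by rewrite muln_gt0 d0.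
exists K => //.
have iz v : zspan G1 v -> val (v *+ d) \is a intmx.
  move=> [s hs ->]; rewrite -sumrMnl (raddf_sum val) big_seq; apply/mxOverP => i j.
  rewrite summxE; apply: rpred_sum => x xs.
  by have /mxOverP := hd x (hs x xs); apply.
have lat Z : qspan G1 Z -> val Z \is a intmx -> zspan G1 (Z *+ K1) /\ G1 (Z *+ (K1 * M)).
  move=> qZ iZ; have [s [es hs e]] := hK1 Z qZ iZ; split; first by exists s.
  by rewrite mulrnA e /M -es; apply: subgroup_mulr_sum.
have KG : scaled_span K `<=` G1.
  move=> _ [v hv <-]; have [|_ h] := lat (v *+ d) _ (iz v hv).
    by apply: zspan_qspan; exact: zspan_mulrn.
  have -> : v *+ K = v *+ d *+ (K1 * M) *+ (E * d).
    by rewrite -!mulrnA; congr (_ *+ _); rewrite /K /K' /L; ring.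
  exact: subgroup_mulrn.
have key Z : qspan G1 Z -> val Z \is a intmx -> scaled_span K (Z *+ (K' * L)).
  move=> qZ iZ; have [h _] := lat Z qZ iZ.
  have -> : Z *+ (K' * L) = Z *+ K1 *+ M *+ K.
    by rewrite -!mulrnA; congr (_ *+ _); rewrite /K /K' /L; ring.
  by exists (Z *+ K1 *+ M) => //; exact: zspan_mulrn.
have KV x : scaled_span K x -> scaled_span K (x^-1)%g by exact: scaled_spanN.
have KM x y : scaled_span K x -> scaled_span K y -> scaled_span K (x * y)%g.
  move=> hx hy; have Gxy : G1 (x * y)%g.
    by have [_ GM _] := sG; apply: GM; exact: KG.
  have hxy := scaled_spanD hx hy.
  case: hx hy Gxy hxy => v hv <- [w hw <-] Gxy hxy.
  have [Z iZ eZ] := hE (v *+ d) (w *+ d) K' (iz v hv) (iz w hw).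
  rewrite -mulrnDl -!mulrnA -/K mulrnDl in eZ.
  set p := (_ * _)%g in Gxy eZ *.
  have qZ : qspan G1 Z.
    apply: (@qspan_divn _ _ _ (K' * K')); first by rewrite muln_gt0 K'0.
    rewrite -eZ; apply: zspan_qspan; apply: zspan_mulrn; apply: zspanD.
      exact: zspan_sub.
    by apply: zspanN => //; apply: zspan_sub; exact: KG.
  have -> : p = (v *+ K + w *+ K) + Z *+ (K' * L).
    apply/eqP; rewrite addrC -subr_eq; apply/eqP; apply: (mulrn_inj E0).
    by rewrite eZ -!mulrnA; congr (_ *+ _); rewrite /K'; ring.
  by apply: scaled_spanD => //; exact: key.
have sK : subgroup (scaled_span K) by split => //; exact: scaled_span0.
split => //; split => //.
- by apply: (bounded_finitely_generated d0) => // x /KG; exact: hd.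
- by move=> x y; exact: scaled_spanD.
move=> x y hx hy.
have qxy := qspan_bracket sG (KG _ hx) (KG _ hy).
case: hx hy qxy => v hv <- [w hw <-].
pose Z := bracket (v *+ d) (w *+ d).
have -> : bracket (v *+ K) (w *+ K) = Z *+ (K' * K').
  by rewrite -bracket_mulrn -!mulrnA.
move=> qZ.
have -> : Z *+ (K' * K') = Z *+ (K' * L) *+ E.
  by rewrite -!mulrnA; congr (_ *+ _); rewrite /K'; ring.
apply: scaled_span_mulrn; apply: key.
  by apply: qspan_divn qZ; rewrite muln_gt0 K'0.
have /mxOverP iv := mxOverM (iz v hv) (iz w hw).
have /mxOverP iw := mxOverM (iz w hw) (iz v hv).
apply/mxOverP => i j; rewrite [val Z]/(val (v *+ d) *m val (w *+ d) - val (w *+ d) *m val (v *+ d)).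
by rewrite mxE [X in _ + X]mxE rpredB.
Qed.

End Construction.

(** * Comparison of the growth functions *)

Section Growth.
Variables (R : realType) (n : nat) (G1 : set (u0 n)) (H : set (u0 n -> u0 n)) (K : nat).
Hypothesis sG : subgroup G1.
Hypothesis HG : subgroup_of_Aut G1 H.
Hypothesis fG : finitely_generated G1.
Hypothesis K0 : (0 < K)%N.
Let G2 := scaled_span G1 K.
Hypothesis sG2 : subgroup G2.
Hypothesis G21 : G2 `<=` G1.
Variables S1 S2 : set (u0 n).
Hypothesis gS1 : finite_generating_set G1 S1.
Hypothesis gS2 : finite_generating_set G2 S2.

Let G11 : G1 1%g. Proof. by case: sG. Qed.
Let G2inv : H_invariant H G2. Proof. exact: scaled_span_invariant. Qed.

(** Invariant normal subgroups of [G1] are cut down to [G2]. *)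
Lemma RF_multiple_le : growth_le
  (RF (R := R) G2 (invariant_normal_subgroups H G2) S2)
  (RF (R := R) G1 (invariant_normal_subgroups H G1) S1).
Proof.
have [/finite_seqP[s2 eS2] e2] := gS2; have [_ e1] := gS1.
have [|L hL] := word_change (S' := S1) eS2.
  by rewrite e1; apply: subset_trans G21; rewrite -e2; exact: sub_generated.
apply: (@growth_le_RF R _ _ _ _ _ _ _ L.+1) => // g k Gg g1 k0 hk.
have [l lk hl] := hL g k hk; exists g; split => //; first exact: G21.
  by exists l => //; apply: leq_trans lk _; rewrite leq_mul2r leqnSn orbT.
apply: separation_index_le => // N iN Ng; exists (N `&` G2); split.
- exact: (invariant_normal_subgroupI HG).
- by case.
have [[sN _ _] _] := iN.
have [->|[c -> hc]] := covered_index R G1 sN; first by rewrite gt0_muley ?leey// lte_fin ltr0n.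
rewrite -EFinM -natrM; apply: subgroup_index_le.
  case: iN => -[[N1 NM NV] _ _] _; case: sG2 => M1 MM MV; split => //.
    by move=> x y [Nx Mx] [Ny My]; split; [exact: NM|exact: MM].
  by move=> x [Nx Mx]; split; [exact: NV|exact: MV].
by apply: (covered_le _ (covered_sub sN sG2 G21 hc)); rewrite mulSn leq_addr.
Qed.

(** An invariant normal subgroup of [G2] is replaced by its normal core in
    [G1]; the core contains a bounded power of each of its elements. *)
Lemma RF_le_multiple : growth_le
  (RF (R := R) G1 (invariant_normal_subgroups H G1) S1)
  (RF (R := R) G2 (invariant_normal_subgroups H G2) S2).
Proof.
have [/finite_seqP[s1 eS1] e1] := gS1; have [_ e2] := gS2.
have [d d0 hd] := bounded_denominators fG.
have cov12 : covered G1 G2 (K ^ (n * n)).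
  by apply: (covered_powers d0 sG hd) => // x; exact: scaled_span_pow.
have [||L hL] := @finite_index_undistorted _ S1 S2 s1 (K ^ (n * n)) eS1.
- by rewrite e1 e2.
- by rewrite e1 e2.
have [M M0 hM] := @subgroup_conj_multiple n K K0.
pose C := (K ^ (n * n) * M ^ (n * n))%N.
apply: (@growth_le_RF R _ _ _ _ _ _ _ (L * K + C).+1) => //; first by case: sG2.
move=> g k Gg g1 k0 hk; exists (g *+ K); split.
- exact: scaled_span_pow.
- by move=> e; apply: g1; apply: (mulrn_inj K0); rewrite e mul0rn.
- have [|||l lk hl] := hL (g *+ K) (K * k)%N.
  + by rewrite e2; exact: scaled_span_pow.
  + by rewrite muln_gt0 K0.
  + by rewrite -expgE_mulrn; exact: wordX.
  exists l => //; apply: leq_trans lk _; rewrite mulnA leq_mul2r.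
  by rewrite -addSn leqW ?orbT// leq_addr.
apply: separation_index_le => // N [[sN N2 Nn] iN] Ng; exists (normal_core G1 N); split.
- by apply: (normal_core_invariant HG sG) => //; exact: subset_trans G21.
- by move=> /(normal_core_sub sG) Nx; apply: Ng; exact: subgroup_mulrn.
have [->|[c -> hc]] := covered_index R G2 sN; first by rewrite gt0_muley ?leey// lte_fin ltr0n.
rewrite -EFinM -natrM; apply: subgroup_index_le; first exact: normal_core_subgroup.
have covN : covered N (normal_core G1 N) (M ^ (n * n)).
  apply: (covered_powers d0 sN) => //; first by move=> x Nx; apply/hd/G21/N2.
    exact: normal_core_subgroup.
  move=> x Nx g' Gg'; rewrite -expgE_mulrn conjXg expgE_mulrn; apply: hM => // j.
  rewrite mulrnA; apply: Nn => //; apply: subgroup_mulrn => //.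
  exact: scaled_span_pow.
apply: (covered_le _ (covered_trans (covered_trans cov12 hc) covN)).
rewrite mulnAC leq_mul2r -/C; apply/orP; right.
by rewrite -addSn leqW// leq_addl.
Qed.

End Growth.

Theorem theorem4p17 (R : realType) (n : nat)
    (G1 : set (u0 n)) (H : set (u0 n -> u0 n)) :
  subgroup G1 -> finitely_generated G1 ->
  torsion_free G1 -> nilpotent_group G1 ->
  subgroup_of_Aut G1 H ->
  exists G2 : set (u0 n),
    [/\ LR_group G2, (G2 `<=` G1)%classic, H_invariant H G2 &
      forall S1 S2 : set (u0 n),
        finite_generating_set G1 S1 -> finite_generating_set G2 S2 ->
        growth_eq (RF (R := R) G1 (invariant_normal_subgroups H G1) S1)
                  (RF (R := R) G2 (invariant_normal_subgroups H G2) S2)].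
Proof.
move=> sG fG _ _ HG; have [K K0 [KG LR]] := exists_LR_multiple sG fG.
have sK : subgroup (scaled_span G1 K) by case: LR.
exists (scaled_span G1 K); split => //; first exact: scaled_span_invariant.
move=> S1 S2 gS1 gS2; split; [exact: RF_le_multiple|exact: RF_multiple_le].
Qed.
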